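(* Let $m\ge1$ be an integer. For $g\ge2$, the symplectic invariants $F^g$ of the curve $x=z+1/z$, $y=z^m/m$ satisfy $$F^g=\frac{1}{m(2g-2)}\left(N^g_1(m+1)-N^g_1(m-1)\right).$$
   Context: Eynard-Orantin invariants of a curve $x=z+1/z$, $y=y(z)$ on $\mathbb{P}^1$ with coordinate $z$, where $y$ is analytic near $z=\pm1$ and $y'(\pm1)\ne0$: the zeros of $dx$ are $z=\pm1$, and near each of them the point $\hat z\neq z$ with $x(\hat z)=x(z)$ is $\hat z=1/z$. Put $\omega^0_1=y\,dx$ and $\omega^0_2=B(w,z)=\frac{dw\,dz}{(w-z)^2}$. For $2g-2+(n+1)>0$, with $S=\{1,\dots,n\}$ and $z_I=(z_i)_{i\in I}$, define recursively $$\omega^g_{n+1}(z_0,z_S)=\sum_{\alpha=\pm1}\operatorname*{Res}_{z=\alpha}K(z_0,z)\Big[\omega^{g-1}_{n+2}(z,\hat z,z_S)+\sum_{\substack{g_1+g_2=g\\ I\sqcup J=S}}\omega^{g_1}_{|I|+1}(z,z_I)\,\omega^{g_2}_{|J|+1}(\hat z,z_J)\Big],$$ where terms containing a factor $\omega^0_1$ are omitted from the inner sum, $\omega^{-1}_{m}=0$, and $$K(z_0,z)=\frac{-\int_{\hat z}^{z}B(z_0,z')}{2\,(y(z)-y(\hat z))\,dx(z)}.$$ For $g\ge2$ the symplectic invariant is defined by $(2g-2)F^g=\sum_{\alpha=\pm1}\operatorname*{Res}_{z=\alpha}\Phi(z)\,\omega^g_1(z)$, where $\Phi$ is any local primitive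 near each $\alpha$ of $y\,dx$, i.e. $d\Phi=y\,dx$ (the choice of constants is immaterial). For $g\ge1$ define $N^g_1(b)$ for positive integers $b$ by the expansion around $z=0$: $\omega_1^g=\sum_{b>0}b\,N^g_1(b)\,z^{b-1}dz$. $N^g_1$ is given by one polynomial in $b^2$ for $b$ even and another for $b$ odd; it is evaluated at arbitrary integers (including $0$ and negative ones) by evaluating the polynomial for the corresponding parity. *)

(* Defs.v *)
From HB Require Import structures.
From mathcomp Require Import all_boot all_order all_algebra.
From mathcomp Require Import complex zify.
From mathcomp Require Import all_classical all_reals all_analysis.

Set Implicit Arguments.
Unset Strict Implicit.
Unset Printing Implicit Defensive.

Import Order.TTheory GRing.Theory Num.Theory.
Import numFieldNormedType.Exports.

Local Open Scope classical_set_scope.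
Local Open Scope ring_scope.

(* The field of complex numbers. Typing it as a numFieldType gives it the     *)
(* topology and the (complex) derivatives that MathComp-Analysis attaches to  *)
(* every numFieldType; the definitions below are given at that generality.    *)
Definition Cplx (R : realType) : numFieldType := R[i]%C.

Section EynardOrantin.
Context {C : numFieldType}.
Implicit Types (y Phi f : C -> C) (z w a c : C) (g h n b m : nat) (zs : seq C).

(* Near a, f(z) = u_0/(z-a) + u_1/(z-a)^2 + ... + u_n/(z-a)^(n+1) + r(z) with *)
(* r holomorphic at a; the coefficient u_0 is the residue.                    *)
Definition is_residue f a c : Prop :=
  exists n (u : nat -> C) (r : C -> C),
    [/\ \forall z \near a, derivable r z 1,
        \forall z \near a^',
          f z = \sum_(k < n.+1) u k / (z - a) ^+ k.+1 + r z
      & c = u 0%N].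

Definition Res f a : C := xget 0 [set c | is_residue f a c].

(* A multidifferential f(z_1,..,z_n) dz_1 .. dz_n is represented by f, a      *)
(* quadratic differential f(z) dz^2 by f.                                     *)

Definition xc z : C := z + z^-1.
(* dx = dx_coef(z) dz *)
Definition dx_coef z : C := 1 - z ^- 2.
(* d(1/z) = dhat_coef(z) dz *)
Definition dhat_coef z : C := - z ^- 2.

Definition B w z : C := (w - z) ^- 2.

(* B(z0,z') has no residue at z' = z0, so its integral over z' from 1/z to z  *)
(* does not depend on the path: it is the difference of the values of the     *)
(* primitive 1/(z0-z').                                                       *)
Definition intB z0 z : C := (z0 - z)^-1 - (z0 - z^-1)^-1.

Definition K y z0 z : C :=
  - intB z0 z / (2 * (y z - y z^-1) * dx_coef z).

(* z_I = (z_i)_(i in I), indices in increasing order *)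
Definition subseq_at zs (I : {set 'I_(size zs)}) : seq C :=
  [seq zs`_i | i : 'I_(size zs) <- enum I].

(* (h,I) = (0,set0) is the index of a factor omega^0_1. *)
Definition unstable1 zs h (I : {set 'I_(size zs)}) : bool :=
  (h == 0%N) && (I == finset.set0).
Arguments unstable1 : clear implicits.

(* The bracket of the recursion as a function of z, for a given family W of   *)
(* lower invariants. Pulling back along z |-> 1/z the slot that carries 1/z   *)
(* produces the factor dhat_coef z.                                           *)
Definition bracket (W : nat -> seq C -> C) g zs z : C :=
  (if g is g'.+1 then W g' [:: z, z^-1 & zs] * dhat_coef z else 0) +
  \sum_(g1 < g.+1)
    \sum_(I : {set 'I_(size zs)} |
            ~~ unstable1 zs g1 I && ~~ unstable1 zs (g - g1)%N (finset.setC I))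
      W g1 (z :: subseq_at I) *
      (W (g - g1)%N (z^-1 :: subseq_at (finset.setC I)) * dhat_coef z).

(* Recursion on 2g + n through the bound k; by omegaE below the value does    *)
(* not depend on k as soon as 2g + n <= k.                                    *)
Fixpoint omega_rec y k g zs {struct k} : C :=
  if k is k'.+1 then
    match g, zs with
    | _, [::] => 0
    | 0%N, [:: z] => y z * dx_coef z
    | 0%N, [:: w; z] => B w z
    | _, z0 :: zS =>
        \sum_(a <- [:: 1; -1])
          Res (fun z => K y z0 z * bracket (omega_rec y k') g zS z) a
    end
  else 0.

(* omega y g [:: z_1; ..; z_n] is the value of omega^g_n at (z_1,..,z_n),     *)
(* meaningful for z_i <> 1, -1.                                               *)
Definition omega y g zs : C := omega_rec y (g.*2 + size zs) g zs.

Definition local_primitive y Phi a : Prop :=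
  \forall z \near a, is_derive (z : C) (1 : C) Phi (y z * dx_coef z).

Definition symplectic_invariant y Phi g : C :=
  (\sum_(a <- [:: 1; -1]) Res (fun z => Phi z * omega y g [:: z]) a) /
  (2 * g - 2)%N%:R.

Definition taylor0 f : nat -> C :=
  xget (fun=> 0) [set t : nat -> C | \forall z \near (0 : C),
                    series (fun k => t k * z ^+ k) @ \oo --> f z].

(* b * N1 y g b is the coefficient of z^(b-1) in omega^g_1; the value at      *)
(* b = 0 is irrelevant.                                                       *)
Definition N1 y g b : C :=
  taylor0 (fun z => omega y g [:: z]) b.-1 / b%:R.

(* (p.1, p.2) are the polynomials, in b^2, giving N1 for b even, resp. odd.   *)
Definition quasi_poly (N : nat -> C) (p : {poly C} * {poly C}) : Prop :=
  forall b, (0 < b)%N -> N b = (if odd b then p.2 else p.1).[b%:R ^+ 2].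

Definition N1Z y g (b : int) : C :=
  let p := xget (0, 0) [set p | quasi_poly (N1 y g) p] in
  (if odd `|b|%N then p.2 else p.1).[b%:~R ^+ 2].

Definition y_monomial m z : C := z ^+ m / m%:R.

Lemma is_derive_hat z : z != 0 ->
  is_derive z (1 : C) (fun u : C => u^-1) (dhat_coef z).
Proof.
move=> z0; have did : derivable (id : C -> C) z 1 by exact: derivable_id.
apply: DeriveDef; first exact: (derivableV (f := id)).
rewrite (deriveV (f := id)) // derive_id.
by rewrite /dhat_coef [_ *: _]mulr1.
Qed.

Lemma is_derive_xc z : z != 0 -> is_derive z (1 : C) xc (dx_coef z).
Proof.
by move=> z0; exact: is_deriveD (is_derive_id z 1) (is_derive_hat z0).
Qed.

Lemma is_derive_primB z0 z : z != z0 ->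
  is_derive z (1 : C) (fun z' : C => (z0 - z')^-1) (B z0 z).
Proof.
move=> zz0; have n0 : z0 - z != 0 by rewrite subr_eq0 eq_sym.
have d : is_derive z (1 : C) (fun z' : C => z0 - z') (- 1).
  have := is_deriveB (is_derive_cst z0 z 1) (is_derive_id z 1).
  by rewrite sub0r.
apply: DeriveDef; first exact: derivableV.
rewrite (deriveV (f := fun z' => z0 - z')) // derive_val.
by rewrite /B scaleNr scalerN opprK [_ *: _]mulr1.
Qed.

Lemma eq_bracket (W W' : nat -> seq C -> C) g zs z :
  (forall h s, (0 < size s)%N -> (h.*2 + size s <= g.*2 + size zs)%N ->
     W h s = W' h s) ->
  bracket W g zs z = bracket W' g zs z.
Proof.
have sz (I : {set 'I_(size zs)}) : size (subseq_at I) = #|I|.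
  by rewrite size_map -cardE.
move=> eqW; rewrite /bracket; congr (_ + _).
  by case: g eqW => // g eqW; rewrite eqW //= doubleS; lia.
apply: eq_bigr => h _; apply: eq_bigr => I.
rewrite /unstable1 => /andP[u1 u2].
have cI := cardsC I; rewrite card_ord in cI.
have {}u1 : (0 < h + #|I|)%N.
  by rewrite addn_gt0 card_gt0 lt0n -negb_and.
have {}u2 : (0 < g - h + #|finset.setC I|)%N.
  by rewrite addn_gt0 card_gt0 lt0n -negb_and.
have hg := ltn_ord h; rewrite ltnS in hg.
by congr (_ * (_ * _)); apply: eqW; rewrite //= sz; lia.
Qed.

Lemma omega_rec_stable y k g zs : (g.*2 + size zs <= k)%N ->
  omega_rec y k g zs = omega y g zs.
Proof.
rewrite /omega; move: {2}(g.*2 + size zs)%N (leqnn (g.*2 + size zs)) => n.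
elim: n k g zs => [|n IH] k g zs.
  by rewrite leqn0 addn_eq0 double_eq0 => /andP[/eqP-> /nilP->]; case: k.
case: k => [|k] len lek.
  by move: lek; rewrite leqn0 => /eqP ->.
case: zs len lek => [|z0 zS]; first by case: g => [|g]; rewrite ?addn0.
move=> len lek; rewrite /= addnS.
have step : \sum_(a <- [:: 1; -1])
    Res (fun z => K y z0 z * bracket (omega_rec y k) g zS z) a =
  \sum_(a <- [:: 1; -1])
    Res (fun z => K y z0 z *
           bracket (omega_rec y (g.*2 + size zS)) g zS z) a.
  apply: eq_bigr => a _; congr (Res _ a); apply/funext => z; congr (_ * _).
  apply: eq_bracket => h s s0 hs; rewrite /= in len lek.
  by rewrite (IH k) ?(IH (g.*2 + size zS)%N) //; lia.
by case: g zS {len lek} step => [|g] [|z1 [|z2 zS]].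
Qed.

Lemma omega01 y z : omega y 0 [:: z] = y z * dx_coef z.
Proof. by []. Qed.

Lemma omega02 y w z : omega y 0 [:: w; z] = B w z.
Proof. by []. Qed.

Lemma omegaE y g z0 zS : (1 < g.*2 + size zS)%N ->
  omega y g (z0 :: zS) =
  \sum_(a <- [:: 1; -1]) Res (fun z => K y z0 z * bracket (omega y) g zS z) a.
Proof.
move=> st; rewrite {1}/omega /= addnS /=.
transitivity (\sum_(a <- [:: 1; -1])
  Res (fun z => K y z0 z * bracket (omega_rec y (g.*2 + size zS)) g zS z) a).
  by case: g zS st => [|g] [|z1 [|z2 zS]].
apply: eq_bigr => a _; congr (Res _ a); apply/funext => z; congr (_ * _).
by apply: eq_bracket => h s _; exact: omega_rec_stable.
Qed.

End EynardOrantin.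

(* Main.v *)
Require Import Defs.
From mathcomp Require Import all_boot all_order all_algebra.
From mathcomp Require Import complex zify ring.
From mathcomp Require Import all_classical all_reals all_analysis.

Set Implicit Arguments.
Unset Strict Implicit.
Unset Printing Implicit Defensive.

Import Order.TTheory GRing.Theory Num.Theory.
Import numFieldNormedType.Exports.

Local Open Scope classical_set_scope.
Local Open Scope ring_scope.

(* Since intB(w,z) = (z - 1/z) / ((w - z) (w - 1/z)), the dependence of the   *)
(* kernel on w is explicit: K(w,z) = K(0,z) / D with, for a = 1 or -1,        *)
(*   D = (w - z) (w - 1/z) = (w - a)^2 - w (z - a)^2 / z.                     *)
(* Expanding 1/D geometrically in (z - a)^2 shows that omega^g_1(w) is the    *)
(* sum over a = 1, -1 of                                                      *)
(*   sum_j d_j w^j / (w - a)^(2j+2),  d_j = Res_a K(0,z) F(z) (z-a)^(2j)/z^j  *)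
(* where F is the bracket of the recursion. No property of F is needed: if    *)
(* K(0,z) F(z) is not meromorphic at a, then neither is K(w,z) F(z) for any   *)
(* w <> a, and all these residues have the default value 0.                   *)
(*   The coefficient of w^(b-1) in w^j / (w - a)^(2j+2) is                    *)
(* a^(b-1-j) 'C(b+j, 2j+1), that is b times an even polynomial in b, whence   *)
(* N^g_1. On the other side the residue at a of w^j / (w - a)^(2j+2) against  *)
(* a primitive of w^(b-1) is the same even polynomial evaluated at b: for     *)
(* b > 0 this is again a binomial coefficient divided by b, and the case      *)
(* b = 0 of a logarithm, needed for m = 1, follows because all the            *)
(* coefficients involved are polynomial in b. As                              *)
(* y dx = (z^m - z^(m-2)) dz / m, taking b = m + 1 and b = m - 1 gives the    *)
(* formula.                                                                   *)

(** * Holomorphic functions and residues *)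

(** Both sides of the formula are linear in the same data. By [omega1_pole_sums], omega^g_1 is given
    away from 1 and -1 by two finite coefficient sequences, one for each zero a of dx, in terms of
    the basis forms w^j / (w - a)^(2j+2) dw. Each basis form is tested in two ways, and the even
    polynomial [central_binom j] answers both tests up to a sign a^(b-1+j). Its Taylor coefficient
    at the origin is b times the value at b^2 ([is_power_series_pole_sum], [central_binom_nat]),
    which determines N^g_1 ([N1Z_pole_sums]). Its residue against a primitive of w^(b-1) is the
    value at b^2 itself ([coef_mul_power_primitive], a Vandermonde convolution), which determines
    F^g ([Res_primitive_pole_sum]). The formula then holds basis form by basis form.

    Two analytic points support this algebra. Residues and Taylor coefficients are defined by
    choice, so they are computed through [residue_unique] and [power_series_unique]. The primitive
    [Phi] is known only through its derivative; the mean value inequality turns this into a Taylor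
    polynomial with holomorphic remainder ([monomial_primitive_taylor]). *)

Definition holomorphic_at {C : numFieldType} (f : C -> C) (a : C) : Prop :=
  \forall z \near a, derivable f z 1.

Section Holomorphic.
Context {C : numFieldType}.
Implicit Types (f g r : C -> C) (a c z w : C) (p q h : {poly C}).

Lemma derivable_continuous f z : derivable f z 1 -> {for z, continuous f}.
Proof. by move=> /derivable1_diffP; exact: differentiable_continuous. Qed.

Lemma eq_holomorphic f g a : f =1 g -> holomorphic_at f a -> holomorphic_at g a.
Proof. by move=> /funext ->. Qed.

Lemma holomorphic_continuous f a : holomorphic_at f a -> {for a, continuous f}.
Proof. by move=> /nbhs_singleton; exact: derivable_continuous. Qed.

Lemma holomorphicD f g a : holomorphic_at f a -> holomorphic_at g a ->
  holomorphic_at (fun z => f z + g z) a.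
Proof. by apply: filterS2 => z; exact: derivableD. Qed.

Lemma holomorphicM f g a : holomorphic_at f a -> holomorphic_at g a ->
  holomorphic_at (fun z => f z * g z) a.
Proof. by apply: filterS2 => z; exact: derivableM. Qed.

Lemma holomorphic_cst c a : holomorphic_at (fun=> c) a.
Proof. by near=> z; exact: derivable_cst. Unshelve. all: by end_near. Qed.

Lemma near_neq0 f a : {for a, continuous f} -> f a != 0 ->
  \forall z \near a, f z != 0.
Proof.
move=> cf fa; apply: (cf [set w | w != 0]).
exists `|f a|; first by rewrite /= normr_gt0.
by move=> w /=; apply: contraTneq => ->; rewrite subr0 ltxx.
Qed.

Lemma holomorphicV f a : holomorphic_at f a -> f a != 0 ->
  holomorphic_at (fun z => (f z)^-1) a.
Proof.
move=> hf fa; have nf := near_neq0 (holomorphic_continuous hf) fa.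
near=> z; apply: derivableV; first by near: z.
by near: z.
Unshelve. all: by end_near. Qed.

Lemma is_derive_horner p z : is_derive z (1 : C) (horner p) p^`().[z].
Proof.
elim/poly_ind: p => [|p c ih].
  rewrite deriv0 horner0 (_ : horner 0 = cst 0); last first.
    by apply/funext => y; rewrite horner0.
  exact: is_derive_cst.
have -> : horner (p * 'X + c%:P) = horner p * id + cst c.
  by apply/funext => y; rewrite !hornerE.
apply: is_derive_eq.
rewrite derivD derivM derivX derivC addr0 mulr1 !hornerE.
by rewrite [_ *: 1]mulr1 [_ *: _]mulrC addrC.
Qed.

Lemma holomorphic_horner p a : holomorphic_at (horner p) a.
Proof.
by near=> z; have [] := is_derive_horner p z.
Unshelve. all: by end_near. Qed.

Lemma horner_shiftE p a : (fun z => p.[z - a]) = horner (p \Po ('X - a%:P)).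
Proof. by apply/funext => z; rewrite horner_comp !hornerE. Qed.

Lemma holomorphic_horner_shift p a b : holomorphic_at (fun z => p.[z - a]) b.
Proof. by rewrite horner_shiftE; exact: holomorphic_horner. Qed.

Lemma holomorphic_shiftX n a b : holomorphic_at (fun z => (z - a) ^+ n) b.
Proof.
apply: eq_holomorphic (holomorphic_horner_shift 'X^n a b) => z.
by rewrite hornerXn.
Qed.

Lemma holomorphicN f a : holomorphic_at f a -> holomorphic_at (fun z => - f z) a.
Proof. by apply: filterS => z; exact: derivableN. Qed.

Lemma holomorphic_rational p h a : h.[a] != 0 ->
  holomorphic_at (fun z => p.[z] / h.[z]) a.
Proof.
move=> ha; apply: holomorphicM (holomorphic_horner p a) _.
exact: (holomorphicV (holomorphic_horner h a)).
Qed.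

End Holomorphic.

(** * Residues: uniqueness, linearity, products with rational functions *)

Section ResidueCalculus.
Context {C : numFieldType}.
Implicit Types (f g r : C -> C) (a b c d z w : C) (p q h : {poly C}) (n k : nat).

Lemma near_dnbhs_neq a : \forall z \near a^', z != a.
Proof. by exists 1 => /=. Qed.

Lemma sum_rev_poles n p a z : z != a ->
  \sum_(k < n.+1) p`_(n - k) / (z - a) ^+ k.+1 =
  (take_poly n.+1 p).[z - a] / (z - a) ^+ n.+1.
Proof.
move=> za; have t0 : z - a != 0 by rewrite subr_eq0.
rewrite /take_poly horner_poly mulr_suml (reindex_inj rev_ord_inj) /=.
apply: eq_bigr => i _; rewrite subSS subKn; last by rewrite -ltnS.
have -> : (z - a) ^+ n.+1 = (z - a) ^+ i * (z - a) ^+ (n - i).+1.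
  by rewrite -exprD; congr (_ ^+ _); have := ltn_ord i; lia.
by rewrite invfM mulrA mulfK ?expf_neq0.
Qed.

(** Listing the polar coefficients in reverse puts the principal part over one denominator, and the
    residue becomes coefficient [n]. The degree of [p] is unbounded, the excess being regular; sums
    and products then stay within this form. *)
Lemma is_residueP f a c : is_residue f a c <->
  exists n p r, [/\ holomorphic_at r a,
    \forall z \near a^', f z = p.[z - a] / (z - a) ^+ n.+1 + r z
    & c = p`_n].
Proof.
split=> [[n [u [r [hr fr ->]]]]|[n [p [r [hr fr ->]]]]].
  exists n, (\poly_(i < n.+1) u (n - i)%N), r; split => //; last first.
    by rewrite coef_poly ltnSn subnn.
  have := near_dnbhs_neq a; apply: filterS2 fr => z -> za; congr (_ + _).
  rewrite -(take_poly_id (size_poly n.+1 (fun i => u (n - i)%N))).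
  rewrite -sum_rev_poles //; apply: eq_bigr => k _.
  have kn : (k <= n)%N by rewrite -ltnS.
  by rewrite coef_poly ltnS leq_subr subKn.
exists n, (fun k => p`_(n - k)), (fun z => (drop_poly n.+1 p).[z - a] + r z).
split; last by rewrite subn0.
  exact: holomorphicD (holomorphic_horner_shift _ a a) hr.
have := near_dnbhs_neq a; apply: filterS2 fr => z -> za.
have t0 : z - a != 0 by rewrite subr_eq0.
rewrite sum_rev_poles // -{1}(poly_take_drop n.+1 p) hornerD hornerM hornerXn.
by field; rewrite expf_neq0.
Qed.

(** Letting z tend to a gives p(0) = 0; a factor z - a is cancelled on both sides and the argument
    repeats. *)
Lemma pole_unique p n r a : {for a, continuous r} ->
  (\forall z \near a^', p.[z - a] = r z * (z - a) ^+ n.+1) -> p`_n = 0.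
Proof.
move=> cr.
have lim0 m q : (\forall z \near a^', q.[z - a] = r z * (z - a) ^+ m.+1) ->
    q.[0] = 0.
  move=> hq.
  have c1 : q.[z - a] @[z --> a^'] --> q.[0].
    rewrite -(subrr a); apply: cvg_within_filter.
    exact: holomorphic_continuous (holomorphic_horner_shift q a a).
  have c2 : q.[z - a] @[z --> a^'] --> (0 : C).
    have -> : 0 = r a * (a - a) ^+ m.+1 by rewrite subrr expr0n mulr0.
    apply: cvg_trans (near_eq_cvg _) _; last first.
      apply: cvg_within_filter; apply: cvgM; first exact: cr.
      exact: holomorphic_continuous (holomorphic_shiftX m.+1 a a).
    by apply: filterS hq => z ->.
  exact: cvg_unique c1 c2.
elim: n p => [|n IH] p hp; first by rewrite -horner_coef0 (lim0 0%N).
have /factor_theorem[q pq] : root p 0 by apply/rootP; exact: lim0 hp.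
move: hp; rewrite pq subr0 coefMX /= => hp; apply: IH.
have := near_dnbhs_neq a; apply: filterS2 hp => z.
rewrite hornerMX [in RHS]exprSr => e za.
by apply: (@mulIf _ (z - a)); rewrite ?subr_eq0 // e exprSr mulrA.
Qed.

Lemma coefMXnD p n k : (p * 'X^k)`_(n + k) = p`_n.
Proof. by rewrite coefMXn addnK ltnNge leq_addl. Qed.

Lemma residue_unique f a c c' :
  is_residue f a c -> is_residue f a c' -> c = c'.
Proof.
move=> /is_residueP[n [p [r [hr fr ->]]]] /is_residueP[n' [p' [r' [hr' fr' ->]]]].
apply/eqP; rewrite -subr_eq0; apply/eqP.
(* The difference of the two principal parts over the common denominator of exponent n + n' + 1. *)
pose q := p * 'X^n' - p' * 'X^n.
have <- : q`_(n + n') = p`_n - p'`_n'.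
  by rewrite coefB coefMXnD addnC coefMXnD.
apply: (@pole_unique _ _ (fun z => (r' z - r z)) a).
  exact: holomorphic_continuous (holomorphicD hr' (holomorphicN hr)).
have := near_dnbhs_neq a; apply: filterS3 fr fr' => z -> e za.
have t0 : z - a != 0 by rewrite subr_eq0.
have -> : r' z - r z = p'.[z - a] / (z - a) ^+ n'.+1 + r' z - r z -
  p'.[z - a] / (z - a) ^+ n'.+1 by ring.
rewrite -e hornerD hornerN !hornerM !hornerXn -addnS exprD exprS exprSr.
by field; rewrite !expf_neq0 // t0.
Qed.

Lemma Res_eq f a c : is_residue f a c -> Res f a = c.
Proof.
by move=> fc; apply: xget_unique => // c' fc'; exact: residue_unique fc' fc.
Qed.

Lemma is_residue_near f g a c : (\forall z \near a^', f z = g z) ->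
  is_residue f a c -> is_residue g a c.
Proof.
move=> fg /is_residueP[n [p [r [hr fr ->]]]]; apply/is_residueP.
by exists n, p, r; split => //; apply: filterS2 fg fr => z -> ->.
Qed.

Lemma is_residue_holomorphic f a : holomorphic_at f a -> is_residue f a 0.
Proof.
move=> hf; apply/is_residueP; exists 0%N, 0, f; split; rewrite ?coef0 //.
by apply: nearW => z; rewrite horner0 mul0r add0r.
Qed.

Lemma is_residueD f g a c d : is_residue f a c -> is_residue g a d ->
  is_residue (fun z => f z + g z) a (c + d).
Proof.
move=> /is_residueP[n [p [r [hr fr ->]]]] /is_residueP[m [q [s [hs gs ->]]]].
apply/is_residueP; exists (n + m)%N, (p * 'X^m + q * 'X^n), (fun z => r z + s z).
split; first exact: holomorphicD.
  have := near_dnbhs_neq a; apply: filterS3 fr gs => z -> -> za.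
  have t0 : z - a != 0 by rewrite subr_eq0.
  rewrite hornerD !hornerM !hornerXn -addnS exprD exprS exprSr.
  by field; rewrite !expf_neq0 // t0.
by rewrite coefD coefMXnD addnC coefMXnD.
Qed.

Lemma is_residueZ b f a c : is_residue f a c ->
  is_residue (fun z => b * f z) a (b * c).
Proof.
move=> /is_residueP[n [p [r [hr fr ->]]]]; apply/is_residueP.
exists n, (b *: p), (fun z => b * r z); split; last by rewrite coefZ.
  exact: (holomorphicM (holomorphic_cst b a) hr).
by apply: filterS fr => z ->; rewrite hornerZ mulrDr mulrA.
Qed.

Lemma is_residue_sum (I : Type) (s : seq I) (f : I -> C -> C) (c : I -> C) a :
  (forall i, is_residue (f i) a (c i)) ->
  is_residue (fun z => \sum_(i <- s) f i z) a (\sum_(i <- s) c i).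
Proof.
move=> fc; elim: s => [|i s IH].
  under eq_fun do rewrite big_nil.
  by rewrite big_nil; apply: is_residue_holomorphic; exact: holomorphic_cst.
under eq_fun do rewrite big_cons.
by rewrite big_cons; exact: is_residueD.
Qed.

(** Subtracting from p / h its value at a leaves a numerator divisible by z - a, which lowers the
    pole order by one. The induction builds the Taylor polynomial of p / h by algebra alone. *)
Lemma rational_pole p h a n : h.[a] != 0 ->
  exists q r, holomorphic_at r a /\ \forall z \near a^',
    p.[z] / h.[z] / (z - a) ^+ n = q.[z - a] / (z - a) ^+ n + r z.
Proof.
move=> ha; elim: n p => [|n IH] p.
  exists 0, (fun z => p.[z] / h.[z]); split; last first.
    by apply: nearW => z; rewrite horner0 divr1 mul0r add0r.
  exact: holomorphic_rational.
have /factor_theorem[k pk] : root (h.[a] *: p - p.[a] *: h) a.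
  by apply/rootP; rewrite !hornerE; ring.
have [q [r [hr qr]]] := IH (h.[a]^-1 *: k).
exists (q * 'X + (p.[a] / h.[a])%:P), r; split => //.
have hz : \forall z \near a^', h.[z] != 0.
  apply: nbhs_dnbhs; apply: near_neq0 => //.
  exact: holomorphic_continuous (holomorphic_horner h a).
have := near_dnbhs_neq a; apply: filterS3 qr hz => z e hz za.
have t0 : z - a != 0 by rewrite subr_eq0.
have {}pk : p.[z] = (p.[a] * h.[z] + k.[z] * (z - a)) / h.[a].
  have := congr1 (horner^~ z) pk; rewrite !hornerE => <-.
  by field.
have -> : r z = (h.[a]^-1 *: k).[z] / h.[z] / (z - a) ^+ n - q.[z - a] / (z - a) ^+ n.
  by rewrite e; ring.
rewrite pk hornerD hornerMX hornerC hornerZ exprS.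
by field; rewrite !expf_neq0 // t0 hz ha.
Qed.

Lemma is_residue_mul_rational f p h a c : h.[a] != 0 -> is_residue f a c ->
  exists d, is_residue (fun z => f z * (p.[z] / h.[z])) a d.
Proof.
move=> ha /is_residueP[n [q [r [hr fr _]]]].
have [q' [r' [hr' qr]]] := @rational_pole ((q \Po ('X - a%:P)) * p) h a n.+1 ha.
exists q'`_n; apply/is_residueP.
exists n, q', (fun z => r' z + r z * (p.[z] / h.[z])).
split; [|apply: filterS2 fr qr => z -> e; rewrite addrA -e|by []].
  exact: (holomorphicD hr' (holomorphicM hr (holomorphic_rational p ha))).
by rewrite hornerM horner_comp hornerXsubC mulrDl mulrACA mulrA [in LHS]mulrAC.
Qed.

Lemma is_residue_mul_high_order f a c : is_residue f a c ->
  exists n, forall N p h, (n <= N)%N -> h.[a] != 0 ->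
    is_residue (fun z => f z * ((z - a) ^+ N * (p.[z] / h.[z]))) a 0.
Proof.
move=> /is_residueP[n [q [r [hr fr _]]]]; exists n.+1 => N p h nN ha.
pose s z := (q.[z - a] * (z - a) ^+ (N - n.+1) + r z * (z - a) ^+ N) *
  (p.[z] / h.[z]).
apply: (@is_residue_near s); last first.
  apply: is_residue_holomorphic; apply: holomorphicM (holomorphic_rational p ha).
  apply: holomorphicD (holomorphicM hr (holomorphic_shiftX N a a)).
  exact: (holomorphicM (holomorphic_horner_shift q a a) (holomorphic_shiftX _ a a)).
have := near_dnbhs_neq a; apply: filterS2 fr => z -> za.
have t0 : z - a != 0 by rewrite subr_eq0.
rewrite /s -(subnK nN) addnK exprD [in RHS]mulrA; congr (_ * _).
rewrite [in RHS]mulrDl; congr (_ + _).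
by rewrite [X in _ = _ / _ * X]mulrC mulrA divfK ?expf_neq0.
Qed.

End ResidueCalculus.

(** * Dependence of the residues on the first variable *)

Definition pole_sum {C : numFieldType} (a : C) (d : {poly C}) (z : C) : C :=
  \sum_(j < size d) d`_j * (z ^+ j / (z - a) ^+ (2 * j + 2)).

Section OnePoint.
Context {C : numFieldType}.
Implicit Types (y F : C -> C) (a z w : C) (d : {poly C}).

Lemma pole_sum_widen a d z n : (size d <= n)%N ->
  pole_sum a d z = \sum_(j < n) d`_j * (z ^+ j / (z - a) ^+ (2 * j + 2)).
Proof.
move=> dn; rewrite /pole_sum (big_ord_widen n
  (fun j => d`_j * (z ^+ j / (z - a) ^+ (2 * j + 2)))) // big_mkcond.
apply: eq_bigr => j _; case: ltnP => // dj.
by rewrite nth_default // mul0r.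
Qed.

(** This is z (w - z) (w - 1/z) = (w - z) (w z - 1), as a polynomial in z. *)
Definition kernel_den w : {poly C} :=
  (w ^+ 2 + 1) *: 'X - w *: ('X^2 + 1).

Lemma kernel_denE w z : (kernel_den w).[z] = (w ^+ 2 + 1) * z - w * (z ^+ 2 + 1).
Proof. by rewrite /kernel_den !hornerE. Qed.

Lemma kernel_den_sqr a w z : a ^+ 2 = 1 ->
  (kernel_den w).[z] = (w - a) ^+ 2 * z - w * (z - a) ^+ 2.
Proof. by rewrite kernel_denE !sqrrB => ->; ring. Qed.

Lemma kernel_den_neq0 a w : a ^+ 2 = 1 -> w != a -> (kernel_den w).[a] != 0.
Proof.
move=> a1 wa; rewrite (kernel_den_sqr _ _ a1) subrr expr0n mulr0 subr0.
have a0 : a != 0 by apply: contra_eq_neq a1 => ->; rewrite expr0n eq_sym oner_eq0.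
by rewrite mulf_neq0 ?expf_neq0 ?subr_eq0.
Qed.

Lemma K_kernel_den y w z : z != 0 -> (kernel_den w).[z] != 0 ->
  K y w z = K y 0 z * ('X.[z] / (kernel_den w).[z]).
Proof.
move=> z0; have e : (kernel_den w).[z] = (w - z) * (w * z - 1).
  by rewrite kernel_denE; ring.
rewrite e mulf_eq0 negb_or => /andP[wz wz1].
rewrite /K hornerX [RHS]mulrAC; congr (_ / _).
rewrite /intB mulNr; congr (- _); rewrite !sub0r.
have wz2 : w - z^-1 != 0.
  by apply: contra_neq wz1 => h; rewrite (subr0_eq h) mulVf // subrr.
by field; rewrite z0 wz wz1.
Qed.

(** By [kernel_den_sqr] this is a geometric expansion of ratio w (z - a)^2 / ((w - a)^2 z), stopped
    after n terms. The exact remainder is (z - a)^(2n) times a rational function regular at z =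
    a. *)
Lemma kernel_expansion a w z n : a ^+ 2 = 1 -> w != a -> z != 0 ->
  (kernel_den w).[z] != 0 ->
  'X.[z] / (kernel_den w).[z] =
  \sum_(j < n) w ^+ j / (w - a) ^+ (2 * j + 2) * ((z - a) ^+ (2 * j) / z ^+ j) +
  (z - a) ^+ (2 * n) *
    ((w ^+ n / (w - a) ^+ (2 * n)) *: 'X).[z] / ('X^n * kernel_den w).[z].
Proof.
move=> a1 wa z0 p0; have w0 : w - a != 0 by rewrite subr_eq0.
have step : z / (kernel_den w).[z] = (w - a) ^- 2 +
    w * (z - a) ^+ 2 / (w - a) ^+ 2 / (kernel_den w).[z].
  have -> : w * (z - a) ^+ 2 = (w - a) ^+ 2 * z - (kernel_den w).[z].
    by rewrite (kernel_den_sqr _ _ a1); ring.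
  by field; rewrite p0.
elim: n => [|n IH].
  by rewrite big_ord0 muln0 !expr0 divr1 scale1r !mul1r add0r.
rewrite IH big_ord_recr -addrA; congr (_ + _).
rewrite !hornerZ !hornerX !hornerM !hornerXn /=.
transitivity ((z - a) ^+ (2 * n) * (w ^+ n / (w - a) ^+ (2 * n)) / z ^+ n *
  (z / (kernel_den w).[z])).
  by field; rewrite p0 !expf_neq0.
rewrite step mulnS !exprD !exprS !expr0.
by field; rewrite p0 z0 w0 !expf_neq0.
Qed.

Lemma Res_kernel y F a : a ^+ 2 = 1 -> exists d,
  forall w, w != a -> Res (fun z => K y w z * F z) a = pole_sum a d w.
Proof.
move=> a1; pose H z := K y 0 z * F z.
have a0 : a != 0 by apply: contra_eq_neq a1 => ->; rewrite expr0n eq_sym oner_eq0.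
have nz : \forall z \near a^', z != 0 /\ z != a.
  have c0 : \forall z \near a, z != 0 by apply: near_neq0 a0; exact: cvg_id.
  by have := near_dnbhs_neq a; apply: filterS2 (nbhs_dnbhs c0).
have nzd w : w != a -> \forall z \near a^', (kernel_den w).[z] != 0.
  move=> wa; apply: nbhs_dnbhs; apply: near_neq0 (kernel_den_neq0 a1 wa).
  exact: holomorphic_continuous (holomorphic_horner _ a).
(* If [H] has no residue at a, neither has the integrand at w, since multiplying that integrand by
   [kernel_den w] / z gives [H] back. [Res] then takes its default value 0, and [d] = 0 works. *)
have [[c Hc]|nH] := pselect (exists c, is_residue H a c); last first.
  exists 0 => w wa; rewrite /pole_sum size_poly0 big_ord0; apply: xgetPN => c /= Kc.
  apply: nH; have Xa : 'X.[a] != 0 by rewrite hornerX.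
  have [c' Hc'] := is_residue_mul_rational (kernel_den w) Xa Kc.
  exists c'; apply: is_residue_near Hc'.
  apply: filterS2 nz (nzd w wa) => z [z0 _] p0.
  by rewrite /H (K_kernel_den _ z0 p0) hornerX; field; rewrite z0 p0.
(* This [n] depends only on the pole of [H], hence not on w. Cutting the expansion after n terms
   leaves a factor (z - a)^(2n), which cancels that pole. *)
have [n Hn] := is_residue_mul_high_order Hc.
have Hj j : exists c, is_residue (fun z => H z * ((z - a) ^+ (2 * j) / z ^+ j)) a c.
  have Xa : ('X^j).[a] != 0 by rewrite hornerXn expf_neq0.
  have [c' Hc'] := is_residue_mul_rational (('X - a%:P) ^+ (2 * j)) Xa Hc.
  exists c'; apply: is_residue_near Hc'; apply: nearW => z.
  by rewrite horner_exp hornerXsubC hornerXn.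
pose d j := Res (fun z => H z * ((z - a) ^+ (2 * j) / z ^+ j)) a.
exists (\poly_(j < n) d j) => w wa; apply: Res_eq.
rewrite (pole_sum_widen _ _ (size_poly _ _)).
rewrite -[X in is_residue _ _ X]addr0.
have := Hn (2 * n)%N ((w ^+ n / (w - a) ^+ (2 * n)) *: 'X) ('X^n * kernel_den w).
rewrite leq_pmull // hornerM hornerXn mulf_neq0 ?expf_neq0 ?kernel_den_neq0 //.
move=> /(_ isT isT) rem.
have Hd j : is_residue (fun z => H z * ((z - a) ^+ (2 * j) / z ^+ j)) a (d j).
  by have [c' Hc'] := Hj j; rewrite /d (Res_eq Hc').
have main := is_residue_sum (index_enum 'I_n) (fun j : 'I_n =>
  is_residueZ (w ^+ j / (w - a) ^+ (2 * j + 2)) (Hd j)).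
have -> : \sum_(j < n) (\poly_(i < n) d i)`_j * (w ^+ j / (w - a) ^+ (2 * j + 2))
  = \sum_(j < n) w ^+ j / (w - a) ^+ (2 * j + 2) * d j.
  by apply: eq_bigr => j _; rewrite coef_poly ltn_ord mulrC.
apply: is_residue_near (is_residueD main rem).
apply: filterS2 nz (nzd w wa) => z [z0 za] p0.
rewrite (K_kernel_den _ z0 p0) [RHS]mulrAC -/(H z) (kernel_expansion n a1 wa z0 p0).
rewrite [RHS]mulrDr mulr_sumr; congr (_ + _); last by rewrite -[in RHS]mulrA.
by apply: eq_bigr => j _; rewrite mulrCA.
Qed.

End OnePoint.

Lemma omega1_pole_sums (C : numFieldType) (y : C -> C) (g : nat) : (1 < g)%N ->
  exists d e, forall z, z != 1 -> z != -1 ->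
    omega y g [:: z] = pole_sum 1 d z + pole_sum (-1) e z.
Proof.
move=> g1; have [d hd] := Res_kernel y (bracket (omega y) g [::]) (expr1n C 2).
have sN1 : (-1) ^+ 2 = 1 :> C by rewrite sqrrN expr1n.
have [e he] := Res_kernel y (bracket (omega y) g [::]) sN1.
exists d, e => z z1 zN1; rewrite omegaE; last by rewrite addn0; lia.
by rewrite !big_cons big_nil addr0 hd // he.
Qed.

(** * Power series at the origin *)

Definition is_power_series {C : numFieldType} (t : nat -> C) (f : C -> C) : Prop :=
  \forall z \near (0 : C), series (fun k => t k * z ^+ k) @ \oo --> f z.

Section PowerSeries.
Context {C : numFieldType}.
Implicit Types (s t : nat -> C) (f : C -> C) (z q : C).

Lemma geometric_sum_le2 q n : 0 <= q -> q *+ 2 <= 1 -> \sum_(i < n) q ^+ i <= 2.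
Proof.
move=> q0 q1; suff : \sum_(i < n) q ^+ i + q ^+ n *+ 2 <= 2.
  by apply: le_trans; rewrite lerDl mulrn_wge0 ?exprn_ge0.
elim: n => [|n IH]; first by rewrite big_ord0 add0r expr0.
rewrite big_ord_recr /=; apply: le_trans IH; rewrite -addrA lerD2l.
rewrite [leRHS]mulr2n lerD2l exprSr -mulrnAr.
by rewrite ler_piMr // exprn_ge0.
Qed.

(** If [s k] is the first nonzero coefficient, the series divided by its leading power has partial
    sums tending to 0, while on a small enough radius the terms after [s k] are dominated by a
    geometric sum smaller than |s k|. Only partial sums are estimated, so completeness of the field
    does not enter. *)
Lemma power_series_eq0 s : is_power_series s (fun=> 0) -> forall k, s k = 0.
Proof.
move=> [e /= e0 hs]; elim/ltn_ind => k IH.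
pose z1 := e / 2; have z1_gt0 : 0 < z1 by rewrite divr_gt0.
have z1e : z1 < e by rewrite /z1 ltr_pdivrMr // mulr_natr mulr2n ltrDl.
have z1n : z1 ^+ k != 0 by rewrite expf_neq0 // gt_eqF.
have cv z : `|z| < e -> series (fun n => s n * z ^+ n) @ \oo --> (0 : C).
  by move=> ze; apply: hs; rewrite /= sub0r normrN.
have [M M0 sM] : exists2 M, 0 < M & forall n, `|s (n + k)%N * z1 ^+ n| <= M.
  have /cvg_series_cvg_0 s0 : cvgn (series (fun n => s n * z1 ^+ n)).
    by apply/cvg_ex; exists 0; apply: cv; rewrite gtr0_norm.
  have /cvg_seq_bounded/pinfty_ex_gt0[M M0 /= hM] : cvgn (fun n => s n * z1 ^+ n).
    by apply/cvg_ex; exists 0.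
  exists (M / z1 ^+ k) => [|n]; first by rewrite divr_gt0 // exprn_gt0.
  rewrite ler_pdivlMr ?exprn_gt0 //.
  have -> : `|s (n + k)%N * z1 ^+ n| * z1 ^+ k = `|s (n + k)%N * z1 ^+ (n + k)|.
    by rewrite exprD mulrA [in RHS]normrM [`|z1 ^+ k|]ger0_norm // exprn_ge0 // ltW.
  exact: hM.
apply/eqP; apply: contraT => sk; pose b := `|s k|.
have b0 : 0 < b by rewrite normr_gt0.
have bM : b <= M by have := sM 0%N; rewrite add0n expr0 mulr1.
(* With this choice q <= 1/2, and the bound 2 M q on the tail is b / 4. *)
pose q := b / (M *+ 8).
have q0 : 0 < q by rewrite divr_gt0 // pmulrn_lgt0.
have q1 : q *+ 2 <= 1.
  rewrite /q -mulrnAl ler_pdivrMr ?pmulrn_lgt0 // mul1r.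
  by apply: (@le_trans _ _ (M *+ 2)); [rewrite lerMn2r bM orbT|by rewrite ler_wpMn2l // ltW].
pose S N := \sum_(n < N) s (n + k)%N * z1 ^+ n * q ^+ n.
have S0 : S @ \oo --> (0 : C).
  have zq : `|q * z1| < e.
    have qz : q * z1 <= z1 by rewrite ler_piMl ?(ltW z1_gt0) //; apply: le_trans q1; rewrite mulr2n lerDl ltW.
    rewrite gtr0_norm; last exact: mulr_gt0.
    exact: le_lt_trans qz z1e.
  have qzk : (q * z1) ^+ k != 0 by rewrite expf_neq0 // mulf_neq0 ?gt_eqF.
  have c := cv _ zq; rewrite -(cvg_shiftn k) in c.
  have {}c := cvgM c (cvg_cst ((q * z1) ^- k)); rewrite mul0r in c.
  have <- : (fun N => series (fun n => s n * (q * z1) ^+ n) (N + k)%N *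
      (q * z1) ^- k) = S; last exact: c.
  apply/funext => N; rewrite /series /= big_mkord addnC big_split_ord /=.
  rewrite big1 => [|i _]; last by rewrite IH // mul0r.
  rewrite add0r mulr_suml; apply: eq_bigr => i _.
  by rewrite addnC exprD mulrA mulfK // exprMn mulrA mulrAC.
have [N _ /(_ N.+1 (leqnSn N)) hN] := (cvgr0Pnorm_lt _).1 S0 (b / 4) (divr_gt0 b0 (ltr0Sn _ _)).
have tail : `|\sum_(n < N) s (n.+1 + k)%N * z1 ^+ n.+1 * q ^+ n.+1| <= M * q * 2.
  apply: le_trans (ler_norm_sum _ _ _) _.
  apply: (@le_trans _ _ (\sum_(n < N) M * q * q ^+ n)).
    apply: ler_sum => i _; rewrite normrM -mulrA -exprS.
    by rewrite [`|q ^+ _|]ger0_norm ?exprn_ge0 ?(ltW q0) // ler_wpM2r ?exprn_ge0 ?(ltW q0).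
  rewrite -mulr_sumr ler_wpM2l //; first by rewrite mulr_ge0 ?(ltW q0) ?(ltW M0).
  by apply: geometric_sum_le2; rewrite ?(ltW q0).
have : b < b.
  have bE : s k = S N.+1 - \sum_(n < N) s (n.+1 + k)%N * z1 ^+ n.+1 * q ^+ n.+1.
    by rewrite /S big_ord_recl /= addrK add0n !expr0 !mulr1.
  rewrite {1}/b bE; apply: le_lt_trans (ler_normB _ _) _.
  apply: lt_le_trans (ltr_leD hN tail) _.
  rewrite /q (_ : _ + _ = b / 2) ?ler_pdivrMr ?mulr_natr ?mulr2n ?lerDl ?ltW //.
  by field; rewrite gt_eqF.
by rewrite ltxx.
Qed.

Lemma power_series_unique s t f :
  is_power_series s f -> is_power_series t f -> s = t.
Proof.
move=> sf tf; apply/funext => k; apply/eqP; rewrite -subr_eq0; apply/eqP.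
apply: (@power_series_eq0 (fun k => s k - t k)).
apply: filterS2 sf tf => z sz tz; rewrite -(subrr (f z)).
have -> : series (fun k => (s k - t k) * z ^+ k) =
    (fun n => series (fun k => s k * z ^+ k) n -
              series (fun k => t k * z ^+ k) n).
  apply/funext => n; rewrite /series /= -sumrB.
  by apply: eq_bigr => i _; rewrite mulrBl.
exact: cvgB.
Qed.

Lemma taylor0_eq t f : is_power_series t f -> taylor0 f = t.
Proof.
by move=> tf; apply: xget_unique => // u uf; exact: power_series_unique uf tf.
Qed.

Lemma is_power_seriesD s t f g : is_power_series s f -> is_power_series t g ->
  is_power_series (fun k => s k + t k) (fun z => f z + g z).
Proof.
apply: filterS2 => z sz tz.
have -> : series (fun k => (s k + t k) * z ^+ k) =
    (fun n => series (fun k => s k * z ^+ k) n +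
              series (fun k => t k * z ^+ k) n).
  apply/funext => n; rewrite /series /= -big_split.
  by apply: eq_bigr => i _; rewrite mulrDl.
exact: cvgD.
Qed.

Lemma is_power_seriesZ a t f : is_power_series t f ->
  is_power_series (fun k => a * t k) (fun z => a * f z).
Proof.
apply: filterS => z tz.
have -> : series (fun k => (a * t k) * z ^+ k) =
    (fun n => a * series (fun k => t k * z ^+ k) n).
  apply/funext => n; rewrite /series /= mulr_sumr.
  by apply: eq_bigr => i _; rewrite mulrA.
exact: cvgM (cvg_cst a) tz.
Qed.

Lemma is_power_series_sum (I : Type) (r : seq I) (t : I -> nat -> C)
    (f : I -> C -> C) : (forall i, is_power_series (t i) (f i)) ->
  is_power_series (fun k => \sum_(i <- r) t i k) (fun z => \sum_(i <- r) f i z).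
Proof.
move=> tf; elim: r => [|i r IH].
  exists 1 => //= z _; rewrite big_nil.
  rewrite (_ : series _ = cst 0); first exact: cvg_cst.
  by apply/funext => n; rewrite /series /= big1 // => k _; rewrite big_nil mul0r.
under eq_fun do rewrite big_cons.
under [X in is_power_series _ X]eq_fun do rewrite big_cons.
exact: is_power_seriesD.
Qed.

End PowerSeries.

(** * Taylor series of pole sums at the origin *)

Section PoleSumSeries.
Context {C : numFieldType}.
Implicit Types (e u a z : C).

(** An Archimedean property, which may fail in a general [numFieldType]; it is carried as a
    hypothesis and supplied for [Cplx R] by [cvg_expr_half]. *)
Let half_powers := (fun n => 2^-1 ^+ n : C) @ \oo --> (0 : C).

Lemma leq_bin_expn m k : ('C(m, k) <= 2 ^ m)%N.
Proof.
elim: m k => [|m IH] [|k] //; first by rewrite bin0 expn_gt0.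
by rewrite binS expnS mul2n -addnn leq_add.
Qed.

Lemma cvg_exp_bounded u (c : nat -> nat) n : half_powers -> `|u| <= 4^-1 ->
  (forall N, (c N <= 2 ^ (N + n))%N) ->
  (fun N => (c N)%:R * u ^+ N) @ \oo --> (0 : C).
Proof.
move=> half u4 cn; apply/cvgr0Pnorm_lt => e e0.
have e2 : 0 < e / 2 ^+ n by rewrite divr_gt0 // exprn_gt0.
have [N _ hN] := (cvgr0Pnorm_lt _).1 half _ e2.
exists N => // m /hN /=; rewrite ltr_pdivlMr ?exprn_gt0 //; apply: le_lt_trans.
rewrite [X in _ <= X * _]ger0_norm ?exprn_ge0 ?invr_ge0 //.
rewrite normrM normr_nat normrX.
apply: (@le_trans _ _ ((2 ^+ (m + n)) * (4^-1) ^+ m)).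
  apply: ler_pM; rewrite ?ler0n ?exprn_ge0 //.
    by rewrite -natrX ler_nat.
  by rewrite lerXn2r ?nnegrE ?invr_ge0.
rewrite exprD mulrAC -exprMn.
suff -> : 2 * 4^-1 = 2^-1 :> C by [].
by field.
Qed.

(** By Pascal's rule, multiplying a partial sum for n + 1 by 1 - u gives the partial sum for n minus
    a boundary term. That term tends to 0 because binomials grow at most like 2^N while |u| <=
    1/4. *)
Lemma negative_binomial_series u n : half_powers -> `|u| <= 4^-1 ->
  series (fun k => 'C(k + n, n)%:R * u ^+ k) @ \oo --> (1 - u) ^- n.+1.
Proof.
move=> half u4; have u1 : 1 - u != 0.
  rewrite subr_eq0; apply: contraTneq u4 => <-; rewrite normr1.
  by rewrite lt_geF // invf_lt1 // ltr1n.
have u0 : (fun N => u ^+ N) @ \oo --> (0 : C).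
  have := @cvg_exp_bounded u (fun=> 1%N) 0 half u4.
  under eq_fun do rewrite mul1r.
  by apply => N; rewrite expn_gt0.
elim: n => [|n IH].
  have -> : series (fun k => 'C(k + 0, 0)%:R * u ^+ k) = (fun N => (1 - u ^+ N) / (1 - u)).
    apply/funext => N; rewrite /series /=; apply: (canRL (mulfK u1)).
    elim: N => [|N IHN]; first by rewrite big_nil mul0r expr0 subrr.
    by rewrite big_nat_recr //= mulrDl IHN bin0 mul1r exprSr; ring.
  have := cvgM (cvgB (cvg_cst (1 : C)) u0) (cvg_cst ((1 - u)^-1 : C)).
  by rewrite subr0 mul1r; apply.
have -> : series (fun k => 'C(k + n.+1, n.+1)%:R * u ^+ k) =
  (fun N => (series (fun k => 'C(k + n, n)%:R * u ^+ k) N -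
             'C(N + n, n.+1)%:R * u ^+ N) / (1 - u)).
  apply/funext => N; rewrite /series /=; apply: (canRL (mulfK u1)).
  elim: N => [|N IHN]; first by rewrite !big_nil mul0r bin_small // mul0r subrr.
  rewrite !big_nat_recr //= mulrDl IHN addnS addSn binS natrD exprSr; ring.
have b0 := cvg_exp_bounded half u4 (fun N => leq_bin_expn (N + n) n.+1).
have := cvgM (cvgB IH b0) (cvg_cst ((1 - u)^-1 : C)).
by rewrite subr0 [in X in _ -> X]exprSr invfM; apply.
Qed.

Definition pole_sum_coef a (d : {poly C}) (k : nat) : C :=
  \sum_(j < size d) d`_j * (a ^+ (k + j) * 'C(k + 1 + j, 2 * j + 1)%:R).

Lemma is_power_series_pole_sum a d : half_powers -> a ^+ 2 = 1 ->
  is_power_series (pole_sum_coef a d) (pole_sum a d).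
Proof.
move=> half a1; apply: is_power_series_sum => j; apply: is_power_seriesZ.
have na : `|a| = 1.
  by apply/eqP; rewrite -(@pexpr_eq1 _ _ 2) // -normrX a1 normr1.
exists 4^-1 => [|z]; rewrite /= ?invr_gt0 // sub0r normrN => z4.
have u4 : `|a * z| <= 4^-1 by rewrite normrM na mul1r ltW.
have aE n : a ^+ (2 * n) = 1 by rewrite exprM a1 expr1n.
(* The first j coefficients vanish, since k + 1 + j < 2j + 1 for k < j; this matches the factor
   z^j. *)
rewrite -(cvg_shiftn j).
have := cvgM (cvg_cst (z ^+ j)) (@negative_binomial_series _ (2 * j + 1) half u4).
have -> : (1 - a * z) ^- (2 * j + 1).+1 = (z - a) ^- (2 * j + 2).
  have -> : z - a = - a * (1 - a * z).
    by rewrite mulrBr mulr1 mulNr mulrA -expr2 a1; ring.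
  rewrite -addnS -mulnSr.
  by rewrite exprMn [(- a) ^+ _]exprM sqrrN a1 expr1n mul1r.
move=> c; rewrite [X in X @ \oo --> _](_ : _ = fun N : nat => z ^+ j *
  series (fun k => 'C(k + (2 * j + 1), 2 * j + 1)%:R * (a * z) ^+ k) N); first exact: c.
apply/funext => N; rewrite /series /= !big_mkord addnC big_split_ord /= big1 => [|i _]; last first.
  by rewrite bin_small ?mulr0 ?mul0r //; have := ltn_ord i; lia.
rewrite add0r mulr_sumr; apply: eq_bigr => i _.
have -> : (j + i + 1 + j = i + (2 * j + 1))%N by lia.
rewrite (_ : (j + i + j = i + 2 * j)%N); last by lia.
by rewrite [a ^+ (_ + _)]exprD aE mulr1 exprMn [z ^+ (_ + _)]exprD; ring.
Qed.

End PoleSumSeries.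

Lemma cvg_expr_half (R : realType) : (fun n => 2^-1 ^+ n : Cplx R) @ \oo --> (0 : Cplx R).
Proof.
apply/cvgr0Pnorm_lt => e e0.
have [r r0 er] : exists2 r : R, 0 < r & e = r%:C%C.
  move: e0; case: (e) => x y; rewrite ltcE /= => /andP[/eqP-> x0].
  by exists x.
have h1 : `|2^-1 : R| < 1 by rewrite ger0_norm ?invr_ge0 // invf_lt1 // ltr1n.
have [N _ hN] := (cvgr0Pnorm_lt _).1 (cvg_expr h1) r r0.
exists N => // n /hN /=; rewrite er.
have -> : (2^-1 ^+ n : R[i]) = (2^-1 ^+ n : R)%:C%C.
  by rewrite rmorphXn fmorphV rmorph_nat.
rewrite !ger0_norm ?ler0c ?exprn_ge0 ?invr_ge0 // => h.
by rewrite ltcR.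
Qed.


(** * Binomial coefficients divided by their upper index *)

Section Interpolation.
Context {C : numFieldType}.
Implicit Types (a s t z : C) (p d : {poly C}).

Lemma poly_eq0_roots p (x : nat -> C) :
  injective x -> (forall n, p.[x n] = 0) -> p = 0.
Proof.
move=> xI px; apply/eqP; apply: contraT => p0.
have := max_poly_roots p0 (rs := map x (iota 0 (size p))).
rewrite size_map size_iota ltnn => -> //; last by rewrite map_inj_uniq ?iota_uniq.
by apply/allP => _ /mapP[n _ ->]; apply/rootP.
Qed.

(* [binom_quot k] takes the value ['C(s, k) / s] at every positive integer [s],
   and at [0] the limit of this ratio. *)
Definition binom_quot k : {poly C} :=
  k`!%:R^-1 *: \prod_(1 <= i < k) ('X - i%:R%:P).

(* The value at [s ^ 2] is ['C(s + j, 2 * j + 1) / s]. *)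
Definition central_binom j : {poly C} :=
  (2 * j + 1)`!%:R^-1 *: \prod_(1 <= i < j.+1) ('X - (i ^ 2)%:R%:P).

Lemma binom_quot1 s : (binom_quot 1).[s] = 1.
Proof. by rewrite /binom_quot big_geq // factS fact0 invr1 scale1r hornerC. Qed.

(** The identity k C(s,k) + (k+1) C(s,k+1) = s C(s,k) divided by s. Being polynomial, it also holds
    at s = 0. *)
Lemma binom_quotS k s : (0 < k)%N ->
  k%:R * (binom_quot k).[s] + k.+1%:R * (binom_quot k.+1).[s] =
  s * (binom_quot k).[s].
Proof.
move=> k0; rewrite /binom_quot big_nat_recr //= factS natrM.
rewrite !hornerZ hornerM hornerXsubC; move: (_.[s]) => u.
have k'0 : k`!%:R != 0 :> C by rewrite pnatr_eq0 -lt0n fact_gt0.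
by field; rewrite k'0 nat1r pnatr_eq0.
Qed.

Lemma binom_quot_nat k (n : nat) : (0 < k)%N ->
  n%:R * (binom_quot k).[n%:R] = 'C(n, k)%:R.
Proof.
elim: k => // [[|k]] IH _; first by rewrite binom_quot1 mulr1 bin1.
have k0 : k.+2%:R != 0 :> C by rewrite pnatr_eq0.
have := binom_quotS n%:R (ltn0Sn k); rewrite IH // => e.
apply: (mulfI k0); rewrite mulrCA.
have {e} -> : k.+2%:R * (binom_quot k.+2).[n%:R] =
  'C(n, k.+1)%:R - k.+1%:R * (binom_quot k.+1).[n%:R] by rewrite -e; ring.
rewrite mulrBr mulrCA IH // -mulrBl.
have [kn|nk] := leqP k.+1 n; last by rewrite !bin_small ?mulr0 // ltnW.
by rewrite -natrB // -!natrM mul_bin_left mulnC.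
Qed.

(** The product (n + j) ... (n - j) pairs symmetrically about n into n times the factors n^2 -
    i^2. *)
Lemma central_binom_nat j (n : nat) :
  n%:R * (central_binom j).[n%:R ^+ 2] = 'C(n + j, 2 * j + 1)%:R.
Proof.
rewrite /central_binom hornerZ.
have f0 : ((2 * j + 1)`!)%:R != 0 :> C by rewrite pnatr_eq0 -lt0n fact_gt0.
apply: (mulfI f0); rewrite mulrCA [X in _ * X = _]mulrA mulfV // mul1r.
rewrite -natrM [(_ * 'C(_, _))%N]mulnC bin_ffact {f0}.
elim: j => [|j IH]; first by rewrite big_geq // hornerC mulr1 addn0 ffactn1.
rewrite big_nat_recr //= hornerM mulrA IH hornerXsubC (addnS n j).
rewrite (_ : (2 * j.+1 + 1 = (2 * j + 1).+2)%N); last by lia.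
rewrite ffactSS ffactnSr.
rewrite natrX !natrM.
(* Truncated subtraction is harmless: when it would truncate, the falling factorial already
   vanishes. *)
have [jn|nj] := leqP (2 * j + 1) (n + j); last by rewrite ffact_small // mulr0n !mul0r mulr0.
rewrite (_ : (n + j - (2 * j + 1) = n - j.+1)%N); last by lia.
rewrite natrB; last by lia.
rewrite -[in RHS]natr1 natrD -natr1. ring.
Qed.

(** For a positive integer s this is Vandermonde's identity for C(s + j, 2j + 1) divided by s.
    Agreement at infinitely many points extends it to every s, in particular to s = 0, the case of
    the logarithm. *)
Lemma central_binomE j s :
  \sum_(i < 2 * j + 1) 'C(j, i)%:R * (binom_quot (2 * j + 1 - i)).[s] =
  (central_binom j).[s ^+ 2].
Proof.
pose p := \sum_(i < 2 * j + 1) 'C(j, i)%:R *: binom_quot (2 * j + 1 - i) -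
  (central_binom j \Po 'X^2).
have pE t : p.[t] = \sum_(i < 2 * j + 1) 'C(j, i)%:R *
    (binom_quot (2 * j + 1 - i)).[t] - (central_binom j).[t ^+ 2].
  rewrite hornerD hornerN horner_sum horner_comp hornerXn; congr (_ - _).
  by apply: eq_bigr => i _; rewrite hornerZ.
apply: subr0_eq; rewrite -pE (@poly_eq0_roots p (fun n => n.+1%:R)) ?horner0 //.
  by move=> m n /eqP; rewrite eqr_nat => /eqP[].
move=> n; rewrite pE; apply: (@mulfI _ n.+1%:R); first by rewrite pnatr_eq0.
rewrite mulr0 mulrBr central_binom_nat (addnC n.+1) -binomial.Vandermonde natr_sum.
rewrite [X in _ - X]big_ord_recr /= (@bin_small j (2 * j + 1)); last by lia.
rewrite mul0n addr0 mulr_sumr; apply/eqP; rewrite subr_eq0; apply/eqP.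
apply: eq_bigr => i _; rewrite mulrCA binom_quot_nat ?natrM //.
by rewrite subn_gt0.
Qed.

(* Taylor polynomial at [z = a], in [t = z - a], of a primitive of [z ^ (s - 1)];
   for [s = 0] this primitive is a logarithm. *)
Definition power_primitive a (s n : nat) : {poly C} :=
  \sum_(1 <= k < n.+1) (a ^+ (s + k) * (binom_quot k).[s%:R]) *: 'X^k.

Lemma coef_power_primitive a (s n k : nat) : (0 < k <= n)%N ->
  (power_primitive a s n)`_k = a ^+ (s + k) * (binom_quot k).[s%:R].
Proof.
move=> kn; rewrite /power_primitive coef_sum (bigD1_seq k) ?iota_uniq //=; last first.
  by rewrite mem_index_iota ltnS.
rewrite coefZ coefXn eqxx mulr1 big1 ?addr0 // => i ik.
by rewrite coefZ coefXn eq_sym (negbTE ik) mulr0.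
Qed.

Lemma coef_XaddC_exp a (j i : nat) : a ^+ 2 = 1 ->
  (('X + a%:P) ^+ j)`_i = a ^+ (j + i) * 'C(j, i)%:R.
Proof.
move=> a1; rewrite addrC exprDn coef_sum.
have [ij|ji] := leqP i j; last first.
  rewrite bin_small // mulr0 big1 // => k _; rewrite coefMn -rmorphXn coefCM coefXn.
  by rewrite gtn_eqF ?mulr0 ?mul0rn // (leq_trans _ ji) ?mul0rn.
rewrite (bigD1 (Ordinal (ij : (i < j.+1)%N))) //= coefMn -rmorphXn coefCM coefXn.
rewrite eqxx mulr1 big1 => [|k ki]; last first.
  rewrite coefMn -rmorphXn coefCM coefXn; case: eqP => [e|]; rewrite ?mulr0 ?mul0rn //.
  by case/eqP: ki; apply/val_inj.
have -> : a ^+ (j + i) = a ^+ (j - i).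
  rewrite (_ : (j + i = (j - i) + 2 * i)%N); last by lia.
  by rewrite exprD exprM a1 expr1n mulr1.
by rewrite addr0 mulr_natr.
Qed.

(** In t = z - a this says that the derivative of the truncated primitive is z^(s-1) + c t^n / z.
    Multiplying by z = t + a avoids the division and treats s = 0 uniformly. *)
Lemma deriv_power_primitive a (s n : nat) : a ^+ 2 = 1 -> (s < n)%N ->
  exists c, ('X + a%:P) * (power_primitive a s n)^`() =
            ('X + a%:P) ^+ s + c *: 'X^n.
Proof.
move=> a1 sn; pose c k := a ^+ (s + k) * (k%:R * (binom_quot k).[s%:R]).
exists (c n); have n0 : (0 < n)%N by exact: leq_ltn_trans sn.
have -> : ('X + a%:P) ^+ s = \poly_(k < n) (a ^+ (s + k) * 'C(s, k)%:R).
  apply/polyP => k; rewrite coef_XaddC_exp // coef_poly; case: ltnP => // nk.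
  by rewrite bin_small ?mulr0 // (leq_trans sn).
(* With (t + a)^s replaced by its truncation, the identity holds for every n > 0, so s < n is
   dropped; the error terms telescope by [binom_quotS]. *)
rewrite poly_def; elim: n n0 {sn} => // [[|n]] IH _.
  rewrite /power_primitive big_nat1 big_ord1 derivZ derivXn /= expr0 /c.
  rewrite binom_quot1 bin0 addn0 addn1 !mulr1 exprSr.
  rewrite -!mul_polyC !rmorphM /= mulr1n mulr1.
  have : a%:P * a%:P = 1 :> {poly C} by rewrite -rmorphM /= -expr2 a1.
  move: (a%:P) (a ^+ s)%:P => A B AA.
  rewrite mulrDl addrC; congr (_ + _); last by ring.
  by rewrite mulrCA AA; ring.
rewrite /power_primitive big_nat_recr //= -/(power_primitive a s n.+1).
rewrite derivD mulrDr IH // [in RHS]big_ord_recr /= -!addrA; congr (_ + _).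
have e2 : 'C(s, n.+1)%:R = n.+1%:R * (binom_quot n.+1).[s%:R] +
    n.+2%:R * (binom_quot n.+2).[s%:R].
  by rewrite binom_quotS // binom_quot_nat.
have ea : a ^+ (s + n.+2) = a ^+ (s + n.+1) * a by rewrite addnS exprSr.
rewrite e2 derivZ derivXn /= /c ea [in 'X^(n.+2)]exprS {ea}.
have AA : a%:P * a%:P = 1 :> {poly C} by rewrite -rmorphM /= -expr2 a1.
rewrite -[_ *+ n.+2]scaler_nat -!mul_polyC.
move: (n.+1%:R : C) (n.+2%:R : C) ('X^(n.+1)) => N1 N2 Y {e2}.
rewrite !(rmorphM, rmorphD) /=.
move: (a%:P) AA ((a ^+ _)%:P) ((_ _).[_]%:P) ((_ _).[_]%:P) => A AA P E1 E2.
move: N1%:P N2%:P => {}N1 {}N2.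
apply/eqP; rewrite -subr_eq0; apply/eqP.
transitivity (N2 * P * E1 * Y * (A * A - 1)); first by ring.
by rewrite AA subrr mulr0.
Qed.

End Interpolation.

(** * Taylor expansion of the primitive of y dx *)

Section DerivativeEstimates.
Context {C : numFieldType}.
Implicit Types (f F : C -> C) (a c l w z : C).

Lemma derive_estimate f z l e : is_derive z (1 : C) f l -> 0 < e ->
  exists2 d, 0 < d & forall w, `|w| < d -> `|f (w + z) - f z - w * l| <= e * `|w|.
Proof.
move=> [df dl] e0; have lim : (fun h => h^-1 *: ((f \o shift z) (h *: 1) - f z)) @ 0^' --> l.
  by rewrite -dl.
have [d /= d0 hd] := (cvgrPdist_lt _ _).1 lim e e0; exists d => // w wd.
have [->|w0] := eqVneq w 0; first by rewrite add0r subrr sub0r mul0r oppr0 normr0 mulr0.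
have := hd w; rewrite /= sub0r normrN => /(_ wd w0) /ltW.
rewrite [w *: 1]mulr1 [_ *: _]mulrC => h.
have -> : f (w + z) - f z - w * l = ((f (w + z) - f z) / w - l) * w by field.
by rewrite normrM distrC ler_pM2r ?normr_gt0.
Qed.

(** Of the n + 3 orders of vanishing, the denominator uses n + 1 and the difference quotient at a
    one more; the remaining order makes the derivative there 0. The value at a is the conventional 0
    / 0 = 0. *)
Lemma remainder_holomorphic f a c n : 0 <= c -> holomorphic_at f a ->
  (\forall z \near a, `|f z - f a| <= c * `|z - a| ^+ n.+3) ->
  holomorphic_at (fun z => (f z - f a) / (z - a) ^+ n.+1) a.
Proof.
move=> c_ge0 hf fc; near=> z; have [->|za] := eqVneq z a; last first.
  apply: derivableM.
    by apply: derivableB; [near: z|exact: derivable_cst].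
  apply: derivableV; first by rewrite expf_neq0 ?subr_eq0.
  exact: nbhs_singleton (holomorphic_shiftX n.+1 a z).
apply/cvg_ex; exists 0; apply/cvgr0Pnorm_lt => e e0.
have c0 : 0 < c + 1 by rewrite ltr_wpDl.
have fh : \forall h \near (0 : C)^', `|f (h + a) - f a| <= c * `|h| ^+ n.+3.
  have cc : (fun h : C => h + a) @ 0^' --> a.
    rewrite -[X in _ --> X]add0r; apply: cvgD; last exact: cvg_cst.
    exact: nbhs_dnbhs.
  near=> h; rewrite -[X in _ <= _ * `|X| ^+ _](addrK a); near: h.
  exact: cc _ fc.
have h1 : \forall h \near (0 : C)^', `|h| <= 1 by exact: dnbhs0_le.
have he : \forall h \near (0 : C)^', `|h| < e / (c + 1).
  by apply: dnbhs0_lt; rewrite divr_gt0.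
have nz := near_dnbhs_neq (0 : C).
near=> h.
have h0 : h != 0 by near: h.
have fh1 : `|f (h + a) - f a| <= c * `|h| ^+ n.+3 by near: h.
have h11 : `|h| <= 1 by near: h.
have he1 : `|h| < e / (c + 1) by near: h.
rewrite /= [h *: 1]mulr1 subrr mul0r subr0 addrK [_ *: _]mulrC.
have nh : 0 < `|h| by rewrite normr_gt0.
rewrite -mulrA -invfM -exprSr normrM normfV normrX.
rewrite ltr_pdivrMr ?exprn_gt0 //; apply: le_lt_trans fh1 _.
rewrite exprS mulrA ltr_pM2r ?exprn_gt0 //.
move: he1; rewrite ltr_pdivlMr //; apply: le_lt_trans.
by rewrite mulrC ler_wpM2l // lerDl.
Unshelve. all: by end_near. Qed.

End DerivativeEstimates.

(** * Mean value inequality for complex functions *)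

Section MeanValue.
Context {R : realType}.
Implicit Types (F : Cplx R -> Cplx R) (h k l z : Cplx R) (s : R).

Lemma Re_real_mul (x : R) (z : R[i]) : complex.Re (x%:C%C * z) = x * complex.Re z.
Proof. by case: z => a b /=; rewrite mul0r subr0. Qed.

Lemma ReB (z w : R[i]) : complex.Re (z - w) = complex.Re z - complex.Re w.
Proof. by case: z; case: w. Qed.

Lemma norm_real_complex (x : R) : `|x%:C%C : R[i]| = `|x|%:C%C.
Proof. by rewrite normc_def /= expr0n addr0 sqrtr_sqr. Qed.

Lemma Re_le_norm (z : R[i]) : (complex.Re z)%:C%C <= `|z|.
Proof.
by apply: le_trans (normc_ge_Re z); rewrite lecR ler_norm.
Qed.

(** A chain rule across two base fields: [F] is differentiated over the complex numbers, the path
    parameter over the reals. *)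
Lemma is_derive_Re_path F k h z s l : is_derive (z + s%:C%C * h) (1 : Cplx R) F l ->
  is_derive s (1 : R) (fun s : R => complex.Re (k * F (z + s%:C%C * h) : R[i]))
            (complex.Re (k * (h * l) : R[i])).
Proof.
move=> dF.
suff lim : (fun x : R => x^-1 *: (complex.Re (k * F (z + (x *: 1 + s)%:C%C * h) : R[i]) -
   complex.Re (k * F (z + s%:C%C * h) : R[i]))) @ 0^' -->
   (complex.Re (k * (h * l) : R[i])).
  apply: DeriveDef; first by apply/cvg_ex; eexists; exact: lim.
  exact: cvg_lim lim.
apply/cvgrPdist_lt => e e0.
pose nrm (x : R[i]) : R := complex.Re `|x|.
have nrmE x : `|x| = (nrm x)%:C%C :> R[i].
  by rewrite /nrm RRe_real // normr_real.
have nrm0 x : 0 <= nrm x by rewrite -ler0c -nrmE.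
pose eps := e / (nrm k * nrm h + 1).
have d0 x y : 0 < nrm x * nrm y + 1 by rewrite ltr_wpDl // mulr_ge0.
have eps0 : 0 < eps%:C%C :> R[i] by rewrite ltcE /= eqxx divr_gt0.
have [d dd hd] := derive_estimate dF eps0.
have [r r0 dr] : exists2 r : R, 0 < r & d = r%:C%C.
  by move: dd; case: (d) => x y; rewrite ltcE /= => /andP[/eqP-> x0]; exists x.
have nz := near_dnbhs_neq (0 : R).
have small : \forall x \near (0 : R)^', `|x| < r / (nrm h + 1).
  by apply: dnbhs0_lt; rewrite divr_gt0 // ltr_wpDl.
near=> x.
have x0 : x != 0 by near: x.
have xs : `|x| < r / (nrm h + 1) by near: x.
have nxh : `|x%:C%C * h : R[i]| = (`|x| * nrm h)%:C%C.
  by rewrite normrM norm_real_complex [`|h|]nrmE rmorphM.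
have := hd (x%:C%C * h); rewrite nxh dr ltcR.
have xr : `|x| * nrm h < r.
  move: xs; rewrite ltr_pdivlMr ?ltr_wpDl //; apply: le_lt_trans.
  by rewrite ler_wpM2l // lerDl.
move=> /(_ xr) est.
pose X := F (x%:C%C * h + (z + s%:C%C * h)) - F (z + s%:C%C * h) - x%:C%C * h * l.
have {est} est : nrm X <= eps * (`|x| * nrm h).
  by rewrite -lecR -nrmE rmorphM.
have zE : z + (x *: 1 + s)%:C%C * h = x%:C%C * h + (z + s%:C%C * h).
  by rewrite [x *: 1]mulr1 rmorphD mulrDl addrCA.
rewrite /= zE distrC.
have -> : x^-1 *: (complex.Re (k * F (x%:C%C * h + (z + s%:C%C * h)) : R[i]) -
      complex.Re (k * F (z + s%:C%C * h) : R[i])) - complex.Re (k * (h * l) : R[i]) =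
    x^-1 * complex.Re (k * X : R[i]).
  have -> : k * X = k * F (x%:C%C * h + (z + s%:C%C * h)) -
      k * F (z + s%:C%C * h) - x%:C%C * (k * (h * l)) by rewrite /X; ring.
  rewrite !ReB Re_real_mul [_ *: _]mulrBr.
  by rewrite [in RHS]mulrBr mulKf // -mulrBr.
rewrite normrM normfV mulrC ltr_pdivrMr ?normr_gt0 //.
have kX : `|complex.Re (k * X : R[i])| <= nrm k * nrm X.
  rewrite -lecR rmorphM /= -!nrmE -normrM; exact: normc_ge_Re.
apply: (le_lt_trans kX).
apply: (@le_lt_trans _ _ (nrm k * (eps * (`|x| * nrm h)))).
  by rewrite ler_wpM2l.
rewrite (_ : nrm k * (eps * (`|x| * nrm h)) = eps * (nrm k * nrm h) * `|x|); last by ring.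
rewrite ltr_pM2r ?normr_gt0 // /eps mulrAC ltr_pdivrMr // ltr_pM2l //.
by rewrite ltrDl.
Unshelve. all: by end_near. Qed.

(** With D the increment of F, the real mean value theorem is applied to the real part of conj(D) F
    along the segment. This real function increases by |D|^2, and its derivative is at most |D| |h|
    M. *)
Lemma mean_value_inequality (F dF : Cplx R -> Cplx R) h z (M : Cplx R) :
  (forall s : R, 0 <= s <= 1 ->
    is_derive (z + s%:C%C * h) (1 : Cplx R) F (dF (z + s%:C%C * h)) /\
    `|dF (z + s%:C%C * h)| <= M) ->
  `|F (z + h) - F z| <= M * `|h|.
Proof.
move=> hF; pose D : Cplx R := F (z + h) - F z.
have [D0|D0] := eqVneq D 0.
  rewrite -/D D0 normr0 mulr_ge0 //; apply: le_trans (proj2 (hF 0 _)) => //.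
  by rewrite lexx ler01.
pose k : Cplx R := (D : R[i])^*%C.
pose g (s : R) : R := complex.Re (k * F (z + s%:C%C * h) : R[i]).
pose dg (s : R) : R := complex.Re (k * (h * dF (z + s%:C%C * h)) : R[i]).
have dergE (s : R) : 0 <= s <= 1 -> is_derive s (1 : R) g (dg s).
  by move=> /hF[dFs _]; exact: is_derive_Re_path.
have [||c c01 gc] := @MVT_segment R g dg 0 1 ler01.
- by move=> s; rewrite in_itv /= => /andP[s0 s1]; apply: dergE; rewrite !ltW.
- apply: derivable_within_continuous => s; rewrite in_itv /= => s01.
  by have [] := dergE s s01.
have c01' : 0 <= c <= 1 by move: c01; rewrite in_itv.
have gD : g 1 - g 0 = complex.Re (k * D : R[i]).
  by rewrite /g rmorph1 mul1r rmorph0 mul0r addr0 -ReB -mulrBr.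
have DD : `|D| ^+ 2 = (dg c)%:C%C.
  rewrite subr0 mulr1 in gc; rewrite -gc gD /k.
  have -> : (D : R[i])^*%C * D = `|D : R[i]| ^+ 2 by rewrite mulrC sqr_normc.
  by rewrite RRe_real // realX // normr_real.
have := Re_le_norm (k * (h * dF (z + c%:C%C * h)) : R[i]).
rewrite -/(dg c) -DD normrM.
have -> : `|k| = `|D| by exact: normcJ.
rewrite expr2 ler_pM2l ?normr_gt0 // => /le_trans; apply.
by rewrite normrM mulrC ler_wpM2r // (proj2 (hF c c01')).
Qed.

End MeanValue.

(** * Residues of a pole sum against a Taylor polynomial *)

Section ResiduePrimitive.
Context {C : numFieldType}.
Implicit Types (a b z : C) (d P : {poly C}) (Phi f : C -> C).

Lemma sqr1_exp a (n k : nat) : a ^+ 2 = 1 -> odd n = odd k -> a ^+ n = a ^+ k.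
Proof.
move=> a1 nk; rewrite -[in LHS](odd_double_half n) -[in RHS](odd_double_half k) nk.
by rewrite !exprD -!mul2n !(exprM a 2) a1 !expr1n.
Qed.

Lemma holomorphic_sum (I : Type) (r : seq I) (f : I -> C -> C) a :
  (forall i, holomorphic_at (f i) a) ->
  holomorphic_at (fun z => \sum_(i <- r) f i z) a.
Proof.
move=> hf; elim: r => [|i r IH].
  by under eq_fun do rewrite big_nil; exact: holomorphic_cst.
by under eq_fun do rewrite big_cons; exact: holomorphicD.
Qed.

Lemma holomorphic_pole_sum a b d : b != a -> holomorphic_at (pole_sum a d) b.
Proof.
move=> ba; apply: holomorphic_sum => j.
apply: (holomorphicM (holomorphic_cst _ b)).
have hb : (('X - a%:P) ^+ (2 * j + 2)).[b] != 0.
  by rewrite horner_exp hornerXsubC expf_neq0 ?subr_eq0.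
apply: eq_holomorphic (holomorphic_rational 'X^j hb) => z.
by rewrite hornerXn horner_exp hornerXsubC.
Qed.

(** The poles have order at most 2 [size d], so the remainder contributes nothing. Since z^j = (t +
    a)^j with t = z - a, each residue is a coefficient of t^(2j+1). *)
Lemma is_residue_mul_pole_sum Phi psi a d P : holomorphic_at psi a ->
  (\forall z \near a^',
    Phi z = P.[z - a] + (z - a) ^+ (2 * size d + 2) * psi z) ->
  is_residue (fun z => Phi z * pole_sum a d z) a
    (\sum_(j < size d) d`_j * (P * ('X + a%:P) ^+ j)`_(2 * j + 1)).
Proof.
move=> hpsi hPhi.
have term (j : 'I_(size d)) :
    is_residue (fun z => Phi z * (z ^+ j / (z - a) ^+ (2 * j + 2))) a
      (P * ('X + a%:P) ^+ j)`_(2 * j + 1).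
  apply/is_residueP; exists (2 * j + 1)%N, (P * ('X + a%:P) ^+ j),
    (fun z => psi z * ((z - a) ^+ (2 * (size d - j)) * z ^+ j)); split; [| |by []].
    apply: (holomorphicM hpsi); apply: (holomorphicM (holomorphic_shiftX _ a a)).
    by apply: eq_holomorphic (holomorphic_shiftX j 0 a) => z; rewrite subr0.
  have := near_dnbhs_neq a; apply: filterS2 hPhi => z -> za.
  have t0 : z - a != 0 by rewrite subr_eq0.
  have e1 : (2 * size d + 2 = 2 * (size d - j) + (2 * j + 2))%N.
    by have := ltn_ord j; clear; lia.
  rewrite e1 exprD hornerM horner_exp hornerD hornerX hornerC subrK -addnS.
  move: (_ ^+ (2 * (size d - j))) => T.
  by field; rewrite expf_neq0.
have := is_residue_sum (index_enum _) (fun j : 'I_(size d) => is_residueZ d`_j (term j)).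
apply: is_residue_near; apply: nearW => z.
by rewrite /pole_sum mulr_sumr; apply: eq_bigr => j _; rewrite mulrCA.
Qed.

(** The Cauchy product is the convolution of [central_binomE]; the powers of a have constant parity
    and factor out. *)
Lemma coef_mul_power_primitive a (s n j : nat) : a ^+ 2 = 1 -> (2 * j + 1 <= n)%N ->
  (power_primitive a s n * ('X + a%:P) ^+ j)`_(2 * j + 1) =
  a ^+ (s + j + 1) * (central_binom j).[s%:R ^+ 2].
Proof.
move=> a1 jn; rewrite coefMr big_ord_recr /= coef_XaddC_exp // bin_small; last first.
  by clear; lia.
rewrite !mulr0 addr0 -central_binomE mulr_sumr; apply: eq_bigr => i _.
rewrite coef_power_primitive; last by have := ltn_ord i; move: jn; clear; lia.
rewrite coef_XaddC_exp //.
rewrite (@sqr1_exp a (s + j + 1) (s + (2 * j + 1 - i) + (j + i))) //; last first.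
  have -> : (s + (2 * j + 1 - i) + (j + i) = s + j + 1 + j.*2)%N.
    by have := ltn_ord i; clear; lia.
  by rewrite [RHS]oddD odd_double addbF.
by rewrite [in RHS]exprD; ring.
Qed.

(** The constant of integration in the primitive is immaterial, as (t + a)^j has degree j < 2j +
    1. *)
Lemma coef_mul_constant a c (j : nat) : a ^+ 2 = 1 ->
  (c%:P * ('X + a%:P) ^+ j)`_(2 * j + 1) = 0.
Proof.
move=> a1; rewrite coefCM coef_XaddC_exp // bin_small ?mulr0 //.
by clear; lia.
Qed.

Lemma deriv_horner_shift P a z :
  is_derive z (1 : C) (fun w => P.[w - a]) P^`().[z - a].
Proof.
rewrite horner_shiftE; have := is_derive_horner (P \Po ('X - a%:P)) z.
by rewrite deriv_comp derivXsubC mulr1 horner_comp hornerXsubC.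
Qed.

End ResiduePrimitive.

(** * The primitive of y dx for y = z^(m+1) / (m+1) *)

Section MonomialCurve.
Context {R : realType}.
Local Notation C := (Cplx R).
Implicit Types (a z c : C) (d e : {poly C}) (Phi psi : C -> C).

Definition monomial_primitive a (m n : nat) : {poly C} :=
  m.+1%:R^-1 *: (power_primitive a m.+2 n - power_primitive a m n).

Lemma deriv_monomial_primitive a (m n : nat) : a ^+ 2 = 1 -> (m.+2 < n)%N ->
  exists c, forall z, z != 0 ->
    y_monomial m.+1 z * dx_coef z - (monomial_primitive a m n)^`().[z - a] =
    c * (z - a) ^+ n / z.
Proof.
move=> a1 mn.
have [c1 e1] := deriv_power_primitive a1 mn.
have [c2 e2] := deriv_power_primitive a1 (ltn_trans (ltnW (ltnSn _)) mn : (m < n)%N).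
exists (m.+1%:R^-1 * (c2 - c1)) => z z0.
have := congr1 (horner^~ (z - a)) e1; have := congr1 (horner^~ (z - a)) e2.
rewrite !(horner_exp, hornerD, hornerX, hornerC, hornerZ) !hornerM.
rewrite !(hornerD, hornerX, hornerC, hornerXn) subrK; move=> {}e2 {}e1; rewrite /monomial_primitive derivZ derivB hornerZ hornerD hornerN.
apply: (mulfI z0); rewrite mulrBr [z * (_^-1 * _)]mulrCA [z * (_ - _)]mulrBr e1 e2.
rewrite /y_monomial /dx_coef !exprS expr0.
have m0 : m.+1%:R != 0 :> C by rewrite pnatr_eq0.
by field; rewrite nat1r m0 z0.
Qed.

(** The difference F between [Phi] and the Taylor polynomial has derivative c (z - a)^N / z. The
    mean value inequality bounds F(z) - F(a) by 2 |c| |z - a|^(n+3), the factor 2 coming from |z| >=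
    1/2 near a, and [remainder_holomorphic] applies. *)
Lemma monomial_primitive_taylor a Phi (m n : nat) : a ^+ 2 = 1 ->
  local_primitive (y_monomial m.+1) Phi a ->
  exists c N psi, [/\ (n <= N)%N, holomorphic_at psi a &
    \forall z \near a^',
      Phi z = (c%:P + monomial_primitive a m N).[z - a] +
              (z - a) ^+ n.+1 * psi z].
Proof.
move=> a1 hPhi; pose N := (n + m + 3)%N.
have mN : (m.+2 < N)%N by rewrite /N; clear; lia.
have [c hc] := deriv_monomial_primitive a1 mN.
pose T := monomial_primitive a m N.
pose F z := Phi z - T.[z - a].
pose dF z := c * (z - a) ^+ N / z.
have na : `|a| = 1.
  by apply/eqP; rewrite -(@pexpr_eq1 _ _ 2) // -normrX a1 normr1.
have a0 : a != 0 by rewrite -normr_gt0 na.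
have dFP : \forall z \near a, is_derive z (1 : C) F (dF z).
  have nz : \forall z \near a, z != 0 by apply: near_neq0 a0; exact: cvg_id.
  apply: filterS2 nz hPhi => z z0 dPhi.
  rewrite /dF -hc //; exact: is_deriveB dPhi (deriv_horner_shift _ _ _).
have hF : holomorphic_at F a by apply: filterS dFP => z [].
exists (F a), N, (fun z => (F z - F a) / (z - a) ^+ n.+1); split.
- by rewrite /N; clear; lia.
- apply: (@remainder_holomorphic _ _ _ (`|c| * 2)) => //.
  have [r /= r0 hr] := dFP.
  have h1 : \forall z \near a, `|a - z| < 2^-1.
    by exists 2^-1 => //=; rewrite invr_gt0.
  have h2 : \forall z \near a, `|a - z| < r by exists r.
  apply: filterS2 h1 h2 => z z1 z2.
  pose h := z - a; have -> : F z = F (a + h) by rewrite addrC subrK.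
  rewrite -/h.
  have nh : `|h| = `|a - z| by rewrite distrC.
  apply: (@le_trans _ _ (`|c| * 2 * `|h| ^+ n.+2 * `|h|)); last first.
    by rewrite -mulrA -exprSr.
  apply: (@mean_value_inequality _ F dF) => s /andP[s0 s1].
  have sh : `|s%:C%C * h| <= `|h|.
    rewrite normrM [`|s%:C%C|]norm_real_complex [`|s|]ger0_norm //.
    have sC : s%:C%C <= 1%:C%C :> R[i] by rewrite lecR.
    by apply: ler_piMl => //; exact: sC.
  split.
    by apply: hr; rewrite /= opprD addrA subrr sub0r normrN (le_lt_trans sh) // nh.
  rewrite /dF [a + _]addrC addrK !normrM normfV normrX.
  have zh : 2^-1 <= `|s%:C%C * h + a|.
    have := lerB_dist a (- (s%:C%C * h)).
    rewrite opprK normrN na [a + _]addrC; apply: le_trans.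
    rewrite lerBrDr -lerBrDl (_ : 1 - 2^-1 = 2^-1); last by field.
    by rewrite (le_trans sh) // nh ltW.
  rewrite mulrAC ler_pM ?mulr_ge0 ?invr_ge0 ?exprn_ge0 //.
    rewrite ler_wpM2l // -[leRHS]invrK lef_pV2 ?posrE ?invr_gt0 //.
    by apply: lt_le_trans zh; rewrite invr_gt0.
  apply: (@le_trans _ _ (`|h| ^+ N)); first by rewrite lerXn2r ?nnegrE.
  have h1' : `|h| <= 1.
    by rewrite nh (le_trans (ltW z1)) // invf_le1 // ler1n.
  by rewrite ler_wiXn2l // /N; clear; lia.
- have := near_dnbhs_neq a; apply: filterS => z za.
  have t0 : z - a != 0 by rewrite subr_eq0.
  rewrite mulrCA mulfV ?expf_neq0 // mulr1 hornerD hornerC /F; ring.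
Qed.

Lemma Res_primitive_pole_sum a Phi d f (m : nat) : a ^+ 2 = 1 ->
  local_primitive (y_monomial m.+1) Phi a -> holomorphic_at f a ->
  Res (fun z => Phi z * (pole_sum a d z + f z)) a =
  m.+1%:R^-1 * \sum_(j < size d) d`_j * a ^+ (m + 1 + j) *
    ((central_binom j).[m.+2%:R ^+ 2] - (central_binom j).[m%:R ^+ 2]).
Proof.
move=> a1 hPhi hf.
have [c [N [psi [nN hpsi PhiE]]]] := monomial_primitive_taylor (2 * size d + 1) a1 hPhi.
have hP : holomorphic_at Phi a by apply: filterS hPhi => z [].
apply: Res_eq; rewrite -[X in is_residue _ _ X]addr0.
have r1 : is_residue (fun z => Phi z * f z) a 0.
  by apply: is_residue_holomorphic; exact: holomorphicM.
rewrite -addnS in PhiE.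
have r2 := is_residue_mul_pole_sum hpsi PhiE.
rewrite mulr_sumr.
set v := \sum_(j < _) _ in r2.
rewrite (_ : \sum_(j < size d) _ = v).
  by apply: is_residue_near (is_residueD r2 r1); apply: nearW => z; rewrite mulrDr.
apply: eq_bigr => j _.
have jN : (2 * j + 1 <= N)%N.
  by apply: leq_trans nN; have := ltn_ord j; clear; lia.
rewrite mulrDl coefD coef_mul_constant // add0r /monomial_primitive.
have coefZM k (p q : {poly C}) i : ((k *: p) * q)`_i = k * (p * q)`_i.
  by rewrite -scalerAl coefZ.
have coefBM (p p' q : {poly C}) i : ((p - p') * q)`_i = (p * q)`_i - (p' * q)`_i.
  by rewrite mulrBl coefB.
rewrite coefZM coefBM !coef_mul_power_primitive //.
rewrite (@sqr1_exp _ a (m.+2 + j + 1) (m + 1 + j)) //; last first.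
  by rewrite !addSn addn1 addnAC addn1 /= negbK.
by rewrite (addnAC m 1); ring.
Qed.

End MonomialCurve.

(** * The quasi-polynomial and the symplectic invariant *)

Lemma Res_near (C : numFieldType) (f f' : C -> C) (a : C) :
  (\forall z \near a^', f z = f' z) -> Res f a = Res f' a.
Proof.
move=> ff'; congr (xget _ _); apply/seteqP; split=> c; apply: is_residue_near => //.
by apply: filterS ff' => z ->.
Qed.

Section QuasiPolynomial.
Context {R : realType}.
Local Notation C := (Cplx R).
Implicit Types (a z : C) (d e : {poly C}) (y : C -> C).

(** The contribution of the pole a to N^g_1 on one parity class. The exponent of a matters only
    modulo 2, where it agrees with b - 1 + j. *)
Definition pole_sum_poly a d (odd_b : bool) : {poly C} :=
  \sum_(j < size d) (d`_j * a ^+ (odd_b + 1 + j)) *: central_binom j.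

Lemma pole_sum_coefE a d (b : nat) : a ^+ 2 = 1 -> (0 < b)%N ->
  pole_sum_coef a d b.-1 = b%:R * (pole_sum_poly a d (odd b)).[b%:R ^+ 2].
Proof.
move=> a1; case: b => // b _; rewrite /= /pole_sum_poly horner_sum mulr_sumr.
apply: eq_bigr => j _.
rewrite hornerZ [in RHS]mulrCA central_binom_nat addn1 mulrA; congr (_ * _ * _).
by apply: sqr1_exp => //; rewrite !oddD /= !oddb; case: (odd b).
Qed.

Lemma N1_pole_sums y (g : nat) d e :
  (forall z, z != 1 -> z != -1 ->
    omega y g [:: z] = pole_sum 1 d z + pole_sum (-1) e z) ->
  forall b, (0 < b)%N -> N1 y g b =
    (pole_sum_poly 1 d (odd b) + pole_sum_poly (-1) e (odd b)).[b%:R ^+ 2].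
Proof.
move=> hom b b0.
have sN1 : (-1) ^+ 2 = 1 :> C by rewrite sqrrN expr1n.
have ps := is_power_seriesD
  (is_power_series_pole_sum d (@cvg_expr_half R) (expr1n C 2))
  (is_power_series_pole_sum e (@cvg_expr_half R) sN1).
have om : is_power_series (fun k => pole_sum_coef 1 d k + pole_sum_coef (-1) e k)
    (fun z => omega y g [:: z]).
  have z1 : \forall z \near (0 : C), `|0 - z| < 1 by exists 1 => /=.
  apply: filterS2 z1 ps => z; rewrite sub0r normrN => z1.
  rewrite hom //; first by apply: contraTneq z1 => ->; rewrite normr1 ltxx.
  by apply: contraTneq z1 => ->; rewrite normrN1 ltxx.
rewrite /N1 (taylor0_eq om) !pole_sum_coefE ?expr1n // -mulrDr hornerD mulrC mulKf //.
by rewrite pnatr_eq0 -lt0n.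
Qed.

(** The polynomials that [N1Z] picks by choice are prescribed at infinitely many squares for each
    parity, so they are the explicit ones, which may be evaluated at any integer, 0 included. *)
Lemma N1Z_pole_sums y (g : nat) d e :
  (forall z, z != 1 -> z != -1 ->
    omega y g [:: z] = pole_sum 1 d z + pole_sum (-1) e z) ->
  forall b : int, N1Z y g b =
    (pole_sum_poly 1 d (odd `|b|) + pole_sum_poly (-1) e (odd `|b|)).[b%:~R ^+ 2].
Proof.
move=> hom b; rewrite /N1Z.
pose q o := pole_sum_poly 1 d o + pole_sum_poly (-1) e o.
have qP : quasi_poly (N1 y g) (q false, q true).
  by move=> k k0; rewrite (N1_pole_sums hom) // -/(q _); case: (odd k).
rewrite (@xget_unique _ _ _ (q false, q true)) //=; first by rewrite -/(q _); case: odd.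
move=> [p0 p1] hp.
have pq (o : bool) : (if o then p1 else p0) = q o.
  apply/eqP; rewrite -subr_eq0; apply/eqP.
  (* The squares of the positive integers of parity [o]. *)
  apply: (@poly_eq0_roots _ _ (fun n => (n.*2 + 2 - o)%:R ^+ 2)).
    move=> k l /eqP; rewrite -!natrX eqr_nat eqn_exp2r // => /eqP.
    by case: o; clear; lia.
  move=> n; have n0 : (0 < n.*2 + 2 - o)%N by case: o; clear; lia.
  have on : odd (n.*2 + 2 - o) = o.
    by case: o {n0}; rewrite ?addn2 ?subn1 ?subn0 /= ?odd_double.
  have e' := hp _ n0; rewrite (qP _ n0) /= on in e'.
  by rewrite hornerD hornerN -e'; case: (o); rewrite subrr.
by rewrite -(pq true) -(pq false).
Qed.

Lemma pole_sum_polyB a d (m : nat) (x x' : C) : a ^+ 2 = 1 ->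
  \sum_(j < size d) d`_j * a ^+ (m + 1 + j) *
    ((central_binom j).[x] - (central_binom j).[x']) =
  (pole_sum_poly a d (odd m)).[x] - (pole_sum_poly a d (odd m)).[x'].
Proof.
move=> a1; rewrite /pole_sum_poly !horner_sum -sumrB; apply: eq_bigr => j _.
rewrite !(hornerZ _ (central_binom j)) -mulrBr; congr (_ * _ * _).
by apply: sqr1_exp => //; rewrite !oddD oddb.
Qed.

End QuasiPolynomial.

Theorem corollary1 (R : realType) (m g : nat) (hm : (1 <= m)%N)
    (hg : (2 <= g)%N) (Phi : Cplx R -> Cplx R)
    (hPhi1 : local_primitive (y_monomial m) Phi 1)
    (hPhiN1 : local_primitive (y_monomial m) Phi (-1)) :
  symplectic_invariant (y_monomial m) Phi g =
  (m * (2 * g - 2))%N%:R^-1 *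
  (N1Z (y_monomial m) g (m%:Z + 1) - N1Z (y_monomial m) g (m%:Z - 1)).
Proof.
case: m hm hPhi1 hPhiN1 => // m _ hPhi1 hPhiN1.
have [d [e hom]] := @omega1_pole_sums (Cplx R) (y_monomial m.+1) g hg.
have N11 : -1 != 1 :> Cplx R by rewrite eq_sym -subr_eq0 opprK -(natrD _ 1 1) pnatr_eq0.
have sN1 : (-1) ^+ 2 = 1 :> Cplx R by rewrite sqrrN expr1n.
have near_neq (a b : Cplx R) : a != b -> \forall z \near a^', z != b.
  rewrite -subr_eq0 => ab; apply: nbhs_dnbhs.
  have := near_neq0 (holomorphic_continuous (holomorphic_shiftX 1 b a)) ab.
  by apply: filterS => z; rewrite subr_eq0.
have N12 : 1 != -1 :> Cplx R by rewrite eq_sym.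
pose f z := Phi z * omega (y_monomial m.+1) g [:: z].
have r1 : Res f 1 = Res (fun z => Phi z * (pole_sum 1 d z + pole_sum (-1) e z)) 1.
  apply: Res_near; have := near_dnbhs_neq (1 : Cplx R).
  by apply: filterS2 (near_neq _ _ N12) => z zN1 z1; rewrite /f hom.
have r2 : Res f (-1) = Res (fun z => Phi z * (pole_sum (-1) e z + pole_sum 1 d z)) (-1).
  apply: Res_near; have := near_dnbhs_neq (-1 : Cplx R).
  by apply: filterS2 (near_neq _ _ N11) => z z1 zN1; rewrite /f hom // addrC.
have sum2 (F : Cplx R -> Cplx R) : \sum_(a <- [:: 1; -1]) F a = F 1 + F (-1).
  by rewrite !big_cons big_nil addr0.
have -> : symplectic_invariant (y_monomial m.+1) Phi g =
    (Res f 1 + Res f (-1)) / (2 * g - 2)%N%:R.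
  by congr (_ / _); exact: sum2 (Res f).
rewrite r1 r2.
rewrite (Res_primitive_pole_sum d (expr1n _ 2) hPhi1 (holomorphic_pole_sum e N12)).
rewrite (Res_primitive_pole_sum e sN1 hPhiN1 (holomorphic_pole_sum d N11)).
rewrite !pole_sum_polyB ?expr1n //.
have -> : m.+1%:Z + 1 = m.+2%:Z by clear; lia.
have -> : m.+1%:Z - 1 = m%:Z by clear; lia.
(* The arguments m + 2 and m have the same parity, so both values come from the same polynomial. *)
rewrite !(N1Z_pole_sums hom) /= negbK -!pmulrn !hornerD natrM invfM.
ring.
Qed.
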